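(* Let $\mu=\sum_{\lambda\in\Lambda}\mu(\lambda)\delta_\lambda$ be an atomic translation bounded measure on $\mathbb{R}^d$ (hence a tempered distribution) whose Fourier transform $\hat\mu$ is also an atomic translation bounded measure. Let $U\subset\Lambda$ and $\varepsilon>0$ be such that for all $\lambda\in U$: (i) $|\mu(\lambda)|\ge\varepsilon$, and (ii) $|\lambda-\lambda'|\ge\varepsilon$ for all $\lambda'\in\Lambda\setminus\{\lambda\}$. Then $U$ is a coherent set of frequencies.
   Context: A measure is atomic if it has the form $\sum_{\lambda\in\Lambda}c_\lambda\delta_\lambda$ with $\Lambda$ countable, $\delta_\lambda$ the unit mass at $\lambda$; we write $\mu(\lambda)=c_\lambda$. A measure $\nu$ on $\mathbb{R}^d$ is translation bounded if $\sup_{t\in\mathbb{R}^d}|\nu|(B(t,1))<\infty$, where $|\nu|$ is the variation. The Fourier transform of a tempered distribution $f$ is defined by $\hat f(\varphi)=f(\hat\varphi)$, with $\hat\varphi(y)=\int\varphi(x)e^{-2\pi i\langle x,y\rangle}dx$. A uniformly discrete set $U\subset\mathbb{R}^d$ is a coherent set of frequencies if every limit, in the topology of uniform convergence on compact subsets of $\mathbb{R}^d$, of a sequence of finite sums $\sum c_\lambda e^{2\pi i\langle x,\lambda\rangle}$ with $\lambda\in U$, $c_\lambda\in\mathbb{C}$, is almost periodic in the sense of H. Bohr. *)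

(* Defs.v *)
From HB Require Import structures.
From mathcomp Require Import all_boot all_order all_algebra.
From mathcomp Require Import all_classical all_reals all_analysis.
From mathcomp Require Import complex.

Set Implicit Arguments.
Unset Strict Implicit.
Unset Printing Implicit Defensive.

Import Order.TTheory GRing.Theory Num.Theory numFieldNormedType.Exports.
Local Open Scope ring_scope.
Local Open Scope classical_set_scope.

Section Defs.
Variable R : realType.
Variable d : nat.

Local Notation V := 'rV[R]_d.
Local Notation C := R[i].

Definition dotp (x y : V) : R := \sum_(i < d) x 0 i * y 0 i.
Definition enorm (x : V) : R := Num.sqrt (dotp x x).

Definition cabs (z : C) : R := ComplexField.Normc.normc z.

Definition cexp2pi (t : R) : C :=
  Complex (cos (2 * pi * t)) (sin (2 * pi * t)).

(* translation bounded: sup_t |mu|(B(t,1)) < oo, where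
   |mu|(B(t,1)) = sum_{l in Lam, |l - t| < 1} |c l|  (supremum over finite
   partial sums). *)
Definition translation_bounded (Lam : set V) (c : V -> C) : Prop :=
  exists M : R, forall (t : V) (s : seq V), uniq s ->
    (forall x, x \in s -> Lam x /\ enorm (x - t) < 1) ->
    \sum_(x <- s) cabs (c x) <= M.

Definition has_sum (A : set V) (a : V -> C) (S : C) : Prop :=
  forall e : R, 0 < e -> exists s0 : seq V,
    [/\ uniq s0, (forall x, x \in s0 -> A x) &
      forall s : seq V, uniq s -> (forall x, x \in s -> A x) ->
        {subset s0 <= s} -> cabs (\sum_(x <- s) a x - S) < e].

Definition ebasis (i : 'I_d) : V := delta_mx 0 i.

Definition pderivs (s : seq 'I_d) (f : V -> R) : V -> R :=
  foldr (fun i g => fun x => 'D_(ebasis i) g x) f s.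

Definition schwartzR (f : V -> R) : Prop :=
  (forall (s : seq 'I_d) (i : 'I_d) (x : V), derivable (pderivs s f) x (ebasis i)) /\
  (forall (s : seq 'I_d) (k : nat), exists M : R, forall x : V,
     (1 + enorm x) ^+ k * `|pderivs s f x| <= M).

Definition schwartz (f : V -> C) : Prop :=
  schwartzR (fun x => complex.Re (f x)) /\ schwartzR (fun x => complex.Im (f x)).

End Defs.

(* Lebesgue integral over R^d, written as an iterated integral over the
   coordinates (by Fubini this equals the Lebesgue integral for integrable
   functions, in particular for all integrands used below). *)
Fixpoint integ (R : realType) (d : nat) : ('rV[R]_d -> R) -> R :=
  match d return ('rV[R]_d -> R) -> R with
  | 0 => fun f => f 0
  | d'.+1 => fun f =>
      Rintegral (@lebesgue_measure R) setT
        (fun x : R => @integ R d' (fun y : 'rV[R]_d' => f (row_mx (const_mx x : 'rV[R]_1) y)))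
  end.

Section Defs2.
Variable R : realType.
Variable d : nat.
Local Notation V := 'rV[R]_d.
Local Notation C := R[i].

Definition cinteg (f : V -> C) : C :=
  Complex (integ (fun x => complex.Re (f x))) (integ (fun x => complex.Im (f x))).

Definition fourier (f : V -> C) : V -> C :=
  fun y => cinteg (fun x => f x * cexp2pi (- dotp x y)).

(* The atomic measure mu = sum_{l in Lam} c l delta_l (Lam countable,
   translation bounded) has as Fourier transform (in the sense of tempered
   distributions: muhat(phi) = mu(phihat) for Schwartz phi) an atomic
   translation bounded measure nu = sum_{g in Gam} b g delta_g. *)
Definition atomic_tb_measure (Lam : set V) (c : V -> C) : Prop :=
  countable Lam /\ translation_bounded Lam c.

Definition fourier_is_atomic_tb (Lam : set V) (c : V -> C) : Prop :=
  exists (Gam : set V) (b : V -> C), atomic_tb_measure Gam b /\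
    forall phi : V -> C, schwartz phi -> exists S : C,
      has_sum Lam (fun l => c l * fourier phi l) S /\
      has_sum Gam (fun g => b g * phi g) S.

Definition uniformly_discrete (U : set V) : Prop :=
  exists2 delta : R, 0 < delta &
    forall u v, U u -> U v -> u <> v -> delta <= enorm (u - v).

Definition exp_sum_on (U : set V) (P : V -> C) : Prop :=
  exists (s : seq V) (a : V -> C), (forall l, l \in s -> U l) /\
    forall x, P x = \sum_(l <- s) a l * cexp2pi (dotp x l).

Definition cvg_compact (P : nat -> V -> C) (f : V -> C) : Prop :=
  forall K : set V, compact K -> forall e : R, 0 < e ->
    exists N : nat, forall n, (N <= n)%N -> forall x, K x ->
      cabs (P n x - f x) < e.

Definition bohr_ap (f : V -> C) : Prop :=
  (forall x (e : R), 0 < e -> exists2 delta : R, 0 < delta &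
     forall y, enorm (y - x) < delta -> cabs (f y - f x) < e) /\
  (forall e : R, 0 < e -> exists2 L : R, 0 < L &
     forall a : V, exists tau : V, enorm (tau - a) < L /\
       forall x, cabs (f (x + tau) - f x) <= e).

Definition coherent (U : set V) : Prop :=
  uniformly_discrete U /\
  forall (P : nat -> V -> C) (f : V -> C),
    (forall n, exp_sum_on U (P n)) -> cvg_compact P f -> bohr_ap f.

End Defs2.

(* Main.v *)
(* Let [psi] be the transform of a bump, dilated so that [psi ^ 2], taken
   coordinatewise, has its spectrum in a cube that meets no other point of
   [Lam] when centred at a point of [U].  Testing the Fourier transform of [mu],
   of masses [b g], against modulated translates of this tensor product gives,
   for a constant [k > 0], all [x] and all [l] in [U],
     k * c l * e(x.l) = sum_g b g * psi_tensor (x + g) * e((x + g).l).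
   So for a trigonometric sum [P] with frequencies in [U] and coefficients
   [a l], the sum with coefficients [a l * c l] is bounded at every [x] by
   [K * sup_(|y| <= r) |P y| + K / (1 + r) * sup |P|].  At [x = 0] the same
   identity makes [c] an absolutely convergent sum of characters on [U], bounded
   below by [eps], and a Wiener type argument shows that dividing the
   coefficients by [c] costs a bounded factor in the sup norm: a partition of
   unity made of bounded multipliers splits the frequencies into finitely many
   pieces on which finitely many characters, hence [c], are nearly constant.
   Taking [r] large gives [sup |P| <= K' * sup_(|y| <= r) |P y|], so locally
   uniform limits of such sums are uniform limits. *)

Require Import Defs.
From HB Require Import structures.
From mathcomp Require Import all_boot all_order all_algebra.
From mathcomp Require Import all_classical all_reals all_analysis.
From mathcomp Require Import complex measurable_realfun.
From mathcomp Require Import ring lra.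

Import Order.TTheory GRing.Theory Num.Theory numFieldNormedType.Exports.
Local Open Scope ring_scope.
Local Open Scope classical_set_scope.

Set Implicit Arguments.
Unset Strict Implicit.
Unset Printing Implicit Defensive.

(** Three difficulties shape the details. The supremum of [P] over the whole space is absorbed into
    the left-hand side, so it must be finite beforehand; a finite sum provides this, and the final
    constants do not depend on that a priori bound. Division by [c] must cost a factor independent
    of the number of frequencies, so closeness of a character to a constant at each frequency of a
    piece is not enough: the difference must be small as a multiplier. Half angle formulas give this
    for one minus a cosine, hence for the square of the difference, and a discrete Landau inequality
    passes to the difference itself. Finally, that [psi] is band-limited is shown without Fourier
    inversion: modulated by a frequency outside its band, [psi] becomes the derivative of a decaying
    function, so its integral vanishes. Squaring doubles the band but makes the weights nonnegative
    and the constant [k] visibly positive, whereas the integral of [psi] itself would have to be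
    computed by inversion. *)

Section ComplexModulus.
Variable R : realType.
Implicit Types (z : R[i]) (r t u : R).

Lemma cabs_ge0 z : 0 <= cabs z.
Proof. by case: z => a b; rewrite /cabs /= sqrtr_ge0. Qed.

Lemma cabs0 : cabs (0 : R[i]) = 0.
Proof. exact: ComplexField.Normc.normc0. Qed.

Lemma cabs1 : cabs (1 : R[i]) = 1.
Proof. exact: ComplexField.Normc.normc1. Qed.

Lemma cabsM z1 z2 : cabs (z1 * z2) = cabs z1 * cabs z2.
Proof. exact: ComplexField.Normc.normcM. Qed.

Lemma cabsN z : cabs (- z) = cabs z.
Proof. exact: normcN. Qed.

Lemma cabsD z1 z2 : cabs (z1 + z2) <= cabs z1 + cabs z2.
Proof. exact: le_normcD. Qed.

Lemma cabsB z1 z2 : cabs (z1 - z2) <= cabs z1 + cabs z2.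
Proof. by rewrite -(cabsN z2) cabsD. Qed.

Lemma cabsC z1 z2 : cabs (z1 - z2) = cabs (z2 - z1).
Proof. by rewrite -cabsN opprB. Qed.

Lemma cabs_dist z1 z2 z3 : cabs (z1 - z3) <= cabs (z1 - z2) + cabs (z2 - z3).
Proof. by rewrite -(subrK z2 z1) -addrA (le_trans (cabsD _ _)) // subrK. Qed.

Lemma cabs_eq0 z : cabs z = 0 -> z = 0.
Proof. exact: ComplexField.Normc.eq0_normc. Qed.

Lemma cabs_real r : cabs (real_complex R r) = `|r|.
Proof. by rewrite /cabs /= expr0n addr0 sqrtr_sqr. Qed.

Lemma cabs_sum (I : Type) (s : seq I) (F : I -> R[i]) :
  cabs (\sum_(i <- s) F i) <= \sum_(i <- s) cabs (F i).
Proof.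
elim: s => [|i s IH]; first by rewrite !big_nil cabs0.
by rewrite !big_cons (le_trans (cabsD _ _)) // lerD2l.
Qed.

Lemma cexp2piD t u : cexp2pi (t + u) = cexp2pi t * cexp2pi u.
Proof.
rewrite /cexp2pi mulrDr cosD sinD /=; apply/eqP; rewrite eq_complex /=.
by rewrite eqxx addrC eqxx.
Qed.

Lemma cexp2pi0 : cexp2pi (0 : R) = 1.
Proof. by rewrite /cexp2pi mulr0 cos0 sin0. Qed.

Lemma cabs_cexp2pi t : cabs (cexp2pi t) = 1.
Proof. by rewrite /cabs /= cos2Dsin2 sqrtr1. Qed.

Lemma cexp2piN t : cexp2pi (- t) * cexp2pi t = 1.
Proof. by rewrite -cexp2piD addNr cexp2pi0. Qed.

Lemma cexp2pi_sum (I : Type) (s : seq I) (F : I -> R) :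
  cexp2pi (\sum_(i <- s) F i) = \prod_(i <- s) cexp2pi (F i).
Proof.
elim: s => [|i s IH]; first by rewrite !big_nil cexp2pi0.
by rewrite !big_cons cexp2piD IH.
Qed.

(** The map [B |-> K + B / 2] contracts to its fixed point [2 * K], so the a priori bound [M],
    however large, disappears in the limit. This is how a supremum over the whole space gets
    absorbed. *)
Lemma half_contraction_bound (T : Type) (f : T -> R) (K M : R) :
  (forall x, f x <= M) ->
  (forall B, (forall x, f x <= B) -> forall x, f x <= K + B / 2) ->
  forall x, f x <= 2 * K.
Proof.
move=> fM fH x.
have H n : forall x, f x <= 2 * K + M / 2 ^+ n + (- 2 * K) / 2 ^+ n.
  elim: n => [|n IH] y.
    by rewrite expr0 !divr1; have := fM y; lra.
  have := fH _ IH y; rewrite exprS invfM.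
  set z := _^-1; set w := z; lra.
apply/ler_addgt0Pr => e e0.
have [n nH] : exists n : nat, `|M - 2 * K| / e < n%:R.
  exists (Num.bound (`|M - 2 * K| / e)); apply: archi_boundP.
  by rewrite divr_ge0 // ltW.
apply: (le_trans (H n x)); rewrite -addrA lerD2l.
have n2 : (n%:R : R) <= 2 ^+ n by rewrite -natrX ler_nat ltnW // ltn_expl.
have p2 : 0 < (2 : R) ^+ n by rewrite exprn_gt0.
rewrite -mulrDl ler_pdivrMr // mulNr.
rewrite ltr_pdivrMr // in nH.
apply: le_trans (ler_norm _) _; apply: (le_trans (ltW nH)).
by rewrite mulrC ler_pM2l.
Qed.

End ComplexModulus.

(** * The scalar product *)

Section Dot.
Variables (R : realType) (d : nat).
Implicit Types x y z : 'rV[R]_d.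

Lemma dotpDl x y z : dotp (x + y) z = dotp x z + dotp y z.
Proof. by rewrite /dotp -big_split; apply: eq_bigr => i _; rewrite mxE mulrDl. Qed.

Lemma dotpZl (r : R) x y : dotp (r *: x) y = r * dotp x y.
Proof. by rewrite /dotp mulr_sumr; apply: eq_bigr => i _; rewrite mxE mulrA. Qed.

Lemma dotpC x y : dotp x y = dotp y x.
Proof. by rewrite /dotp; apply: eq_bigr => i _; rewrite mulrC. Qed.

Lemma dotpNl x y : dotp (- x) y = - dotp x y.
Proof. by rewrite -scaleN1r dotpZl mulN1r. Qed.

Lemma dotp0l y : dotp 0 y = 0.
Proof. by rewrite -(scale0r (0 : 'rV[R]_d)) dotpZl mul0r. Qed.

End Dot.

(** * Multipliers that are bounded in the sup norm *)

Section Multipliers.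
Variables (R : realType) (d : nat).
Local Notation V := 'rV[R]_d.
Local Notation C := R[i].
Implicit Types (S U : set V) (m : V -> C) (y B : R) (s : seq V) (a : V -> C).
Local Notation "r %:C" := (real_complex R r).

Definition expsum s a (x : V) : C := \sum_(l <- s) a l * cexp2pi (dotp x l).

Lemma expsum_bounded s a x : cabs (expsum s a x) <= \sum_(l <- s) cabs (a l).
Proof.
apply: le_trans (cabs_sum _ _) _; apply: ler_sum => l _.
by rewrite cabsM cabs_cexp2pi mulr1.
Qed.

Lemma eq_expsum s a a' x : (forall l, l \in s -> a l = a' l) ->
  expsum s a x = expsum s a' x.
Proof. by move=> H; apply: eq_big_seq => l /H ->. Qed.

Lemma expsumD s a a' x :
  expsum s (fun l => a l + a' l) x = expsum s a x + expsum s a' x.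
Proof. by rewrite /expsum -big_split; apply: eq_bigr => l _; rewrite mulrDl. Qed.

Lemma expsumZ s a z x : expsum s (fun l => z * a l) x = z * expsum s a x.
Proof. by rewrite /expsum mulr_sumr; apply: eq_bigr => l _; rewrite mulrA. Qed.

(** [y] bounds the norm of an operator on all finite sums with frequencies in [S], whatever their
    length. Shrinking [S] can make this norm small, which localization exploits. *)
Definition bounded_multiplier S m y := 0 <= y /\ forall s a B,
  (forall l, l \in s -> S l) -> (forall x, cabs (expsum s a x) <= B) ->
  forall x, cabs (expsum s (fun l => a l * m l) x) <= y * B.

Local Notation NB := bounded_multiplier.

Lemma NB_ext S m m' y : (forall l, S l -> m l = m' l) -> NB S m y -> NB S m' y.
Proof.
move=> E [y0 H]; split => // s a B sS aB x.
rewrite (@eq_expsum _ _ (fun l => a l * m l)); first exact: H.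
by move=> l /sS /E ->.
Qed.

Lemma NB_le S m y y' : y <= y' -> NB S m y -> NB S m y'.
Proof.
move=> yy [y0 H]; split; first exact: le_trans yy.
move=> s a B sS aB x; apply: (le_trans (H _ _ _ sS aB x)).
by rewrite ler_wpM2r // (le_trans (cabs_ge0 _) (aB 0)).
Qed.

Lemma NB_add S m m' y y' : NB S m y -> NB S m' y' ->
  NB S (fun l => m l + m' l) (y + y').
Proof.
move=> [y0 H] [y0' H']; split; first exact: addr_ge0.
move=> s a B sS aB x.
under eq_expsum do rewrite mulrDr.
by rewrite expsumD mulrDl (le_trans (cabsD _ _)) // lerD // ?H ?H'.
Qed.

Lemma NB_mul S m m' y y' : NB S m y -> NB S m' y' ->
  NB S (fun l => m l * m' l) (y * y').
Proof.
move=> [y0 H] [y0' H']; split; first exact: mulr_ge0.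
move=> s a B sS aB x.
under eq_expsum do rewrite mulrA.
by rewrite (mulrC y) -mulrA; apply: H' => // x'; apply: H.
Qed.

Lemma NB_cst S z : NB S (fun=> z) (cabs z).
Proof.
split; first exact: cabs_ge0.
move=> s a B sS aB x.
under eq_expsum do rewrite mulrC.
by rewrite expsumZ cabsM ler_wpM2l // cabs_ge0.
Qed.

Lemma NB_cst_mul S z m y : NB S m y -> NB S (fun l => z * m l) (cabs z * y).
Proof. by move=> H; apply: NB_mul => //; apply: NB_cst. Qed.

Lemma NB_char S g : NB S (fun l => cexp2pi (dotp g l)) 1.
Proof.
split=> // s a B sS aB x; rewrite mul1r.
suff -> : expsum s (fun l => a l * cexp2pi (dotp g l)) x = expsum s a (x + g).
  exact: aB.
by apply: eq_bigr => l _; rewrite -mulrA -cexp2piD addrC -dotpDl addrC.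
Qed.

(** A given sum has finitely many frequencies, so [m] need only be approximated on that list,
    provided that the norm [y] does not depend on the list or on the precision. *)
Lemma NB_lim S m y : 0 <= y ->
  (forall s e, (forall l, l \in s -> S l) -> 0 < e -> exists2 m', NB S m' y &
     forall l, l \in s -> cabs (m l - m' l) <= e) ->
  NB S m y.
Proof.
move=> y0 H; split => // s a B sS aB x.
apply/ler_addgt0Pr => e e0.
have A0 : 0 <= \sum_(l <- s) cabs (a l) by apply: sumr_ge0 => l _; exact: cabs_ge0.
have A1 : 0 < \sum_(l <- s) cabs (a l) + 1 by rewrite ltr_wpDl.
(* The added 1 keeps the denominator positive when all coefficients vanish. *)
have [m' [_ mH] mm] := H s (e / (\sum_(l <- s) cabs (a l) + 1)) sS (divr_gt0 e0 A1).
rewrite (@eq_expsum _ _ (fun l => a l * m' l + a l * (m l - m' l))); last first.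
  by move=> l _; rewrite -mulrDr subrKC.
rewrite expsumD (le_trans (cabsD _ _)) // lerD //; first exact: mH.
apply: (le_trans (expsum_bounded _ _ _)).
apply: (@le_trans _ _ (\sum_(l <- s) cabs (a l) * (e / (\sum_(l <- s) cabs (a l) + 1)))).
  rewrite big_seq [leRHS]big_seq; apply: ler_sum => l ls.
  by rewrite cabsM ler_wpM2l ?cabs_ge0 // mm.
rewrite -mulr_suml mulrCA ger_pMr // ler_pdivrMr // mul1r; lra.
Qed.

(* [u = 1 - sqrt (1 - x)] solves [u = (x + u ^ 2) / 2]; the iteration of this
   equation has nonnegative coefficients. *)
Fixpoint sqrt_iter n (x : R) : R :=
  if n is n'.+1 then (x + sqrt_iter n' x ^+ 2) / 2 else 0.

Lemma sqrt_iter_ge0 n x : 0 <= x -> 0 <= sqrt_iter n x.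
Proof. by move=> x0; elim: n => //= n IH; rewrite divr_ge0 // addr_ge0 // sqr_ge0. Qed.

(** With [w = sqrt (1 - x)] the error [e] becomes [e * (1 - w - e / 2) <= e * (1 - e / 2)]. At
    [x = 1] the linear contraction is lost, hence only a rate of order [1 / n], but one that is
    uniform up to this endpoint. *)
Lemma sqrt_iter_err n (x : R) : 0 <= x <= 1 ->
  0 <= 1 - Num.sqrt (1 - x) - sqrt_iter n x <= 2 / (n.+2)%:R.
Proof.
move=> /andP[x0 x1].
move w_def : (Num.sqrt (1 - x)) => w.
have w0 : 0 <= w by rewrite -w_def sqrtr_ge0.
have w2 : w ^+ 2 = 1 - x by rewrite -w_def sqr_sqrtr // subr_ge0.
have w1 : w <= 1 by nra.
elim: n => [|n /andP[IH0 IH1]] /=.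
  by rewrite divff // subr0; apply/andP; split; lra.
have := sqrt_iter_ge0 n x0; move: (sqrt_iter n x) IH0 IH1 => u IH0 IH1 u0.
apply/andP; split; first nra.
set e := 1 - w - u in IH0 IH1.
have -> : 1 - w - (x + u ^+ 2) / 2 = e * (1 - w - e / 2).
  rewrite /e; have -> : x = 1 - w ^+ 2 by rewrite w2; ring.
  by field.
have n0 : (0 : R) < n.+2%:R by rewrite ltr0n.
have n1 : (n.+3%:R : R) = n.+2%:R + 1 by rewrite -natr1.
set t := (n.+2%:R)^-1 in IH1.
have tn : t * n.+2%:R = 1 by rewrite mulVf // lt0r_neq0.
have tp : 0 < t by rewrite invr_gt0.
have t12 : 2 * t <= 1.
  have : (2 : R) <= n.+2%:R by rewrite ler_nat.
  nra.
have e1 : e <= 1 by lra.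
rewrite n1 ler_pdivlMr; last lra.
have E1 : e * (1 - w - e / 2) <= e * (1 - e / 2) by nra.
have E2 : e * (1 - e / 2) <= (2 * t) * (1 - t) by nra.
have n3 : (0 : R) <= n.+2%:R + 1 by lra.
apply: (le_trans (ler_wpM2r n3 (le_trans E1 E2))).
nra.
Qed.

(** As its coefficients are nonnegative, the iteration applied to a multiplier of norm at most [y]
    has norm at most the same iteration at the number [y], which stays below its limit. *)
Lemma NB_sqrt S (x : V -> R) y : (forall l, S l -> 0 <= x l <= 1) -> y <= 1 ->
  NB S (fun l => (x l)%:C) y ->
  NB S (fun l => (1 - Num.sqrt (1 - x l))%:C) (1 - Num.sqrt (1 - y)).
Proof.
move=> x01 y1 Hx; have y0 := Hx.1.
have yH n := @sqrt_iter_err n y.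
have H n : NB S (fun l => (sqrt_iter n (x l))%:C) (sqrt_iter n y).
  elim: n => [|n IH] /=.
    by have := NB_cst S 0; rewrite cabs0; apply: NB_ext => l _.
  have := NB_cst_mul (2^-1)%:C (NB_add Hx (NB_mul IH IH)).
  rewrite cabs_real ger0_norm ?invr_ge0 // mulrC -expr2; apply: NB_ext => l _.
  by rewrite -expr2 -rmorphXn -rmorphD -rmorphM mulrC.
apply: NB_lim => [|s e sS e0].
  have y01 : 0 <= y <= 1 by rewrite y0.
  by have := sqrt_iter_err 0 y01 => /= /andP[]; rewrite subr0.
have [n nH] : exists n : nat, 2 / e < n%:R.
  by exists (Num.bound (2 / e)); apply: archi_boundP; rewrite divr_ge0 // ltW.
exists (fun l => (sqrt_iter n (x l))%:C) => [|l /sS Sl].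
  apply: NB_le (H n); have := yH n; rewrite y0 y1 => /(_ isT) /andP[]; lra.
rewrite -rmorphB cabs_real.
have /andP[p q] := @sqrt_iter_err n _ (x01 _ Sl).
rewrite ger0_norm //; apply: (le_trans q).
rewrite ler_pdivrMr ?ltr0n //; rewrite ltr_pdivrMr // in nH.
apply: (le_trans (ltW nH)); rewrite mulrC ler_pM2l // ler_nat.
by rewrite leqW // leqW.
Qed.

End Multipliers.

(** * Multipliers obtained from characters by square roots *)

Section Localization.
Variables (R : realType) (d : nat).
Local Notation V := 'rV[R]_d.
Local Notation C := R[i].
Implicit Types (S U : set V) (m : V -> C) (y B : R) (s : seq V) (a : V -> C).
Local Notation "r %:C" := (real_complex R r).
Local Notation NB := bounded_multiplier.

Definition cs (t : R) : R := cos (2 * pi * t).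
Definition sn (t : R) : R := sin (2 * pi * t).

Lemma cs2Dsn2 t : cs t ^+ 2 + sn t ^+ 2 = 1.
Proof. exact: cos2Dsin2. Qed.

Lemma csB t u : cs (t - u) = cs t * cs u + sn t * sn u.
Proof. by rewrite /cs /sn mulrBr cosB. Qed.

Lemma sn_double t : sn (2 * t) = 2 * cs t * sn t.
Proof.
rewrite /sn /cs; have -> : 2 * pi * (2 * t) = 2 * pi * t + 2 * pi * t by ring.
by rewrite sinD; ring.
Qed.

Lemma cs_double t : cs (2 * t) = 2 * cs t ^+ 2 - 1.
Proof.
rewrite /cs; have -> : 2 * pi * (2 * t) = 2 * pi * t + 2 * pi * t by ring.
rewrite cosD -!expr2; have := cos2Dsin2 (2 * pi * t); set c := cos _; set b := sin _.
move=> H; have -> : b ^+ 2 = 1 - c ^+ 2 by rewrite -H addrC addKr.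
ring.
Qed.

Lemma cs_shift t : cs t = sn (t + 4^-1).
Proof.
rewrite /cs /sn; have -> : 2 * pi * (t + 4^-1) = 2 * pi * t + pi / 2 :> R by field.
by rewrite sinDpihalf.
Qed.

Lemma sn_shift t : sn t = cs (t - 4^-1).
Proof. by rewrite cs_shift subrK. Qed.

Lemma cs_cexp t : (cs t)%:C = (2^-1)%:C * (cexp2pi t + cexp2pi (- t)).
Proof.
rewrite /cexp2pi mulrN cosN sinN /cs; apply/eqP; rewrite eq_complex /=.
by apply/andP; split; apply/eqP; field.
Qed.

Lemma NB_shift_char S g t : NB S (fun l => cexp2pi (dotp g l + t)) 1.
Proof.
have := NB_mul (NB_char S g) (NB_cst S (cexp2pi t)).
rewrite cabs_cexp2pi mul1r; apply: NB_ext => l _; by rewrite cexp2piD.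
Qed.

Lemma NB_cs S g t : NB S (fun l => (cs (dotp g l + t))%:C) 1.
Proof.
have := NB_cst_mul (2^-1)%:C (NB_add (NB_shift_char S g t) (NB_shift_char S (- g) (- t))).
rewrite cabs_real ger0_norm ?invr_ge0 // -mulr2n mulVf //.
by apply: NB_ext => l _; rewrite cs_cexp dotpNl opprD.
Qed.

Lemma NB_sn S g t : NB S (fun l => (sn (dotp g l + t))%:C) 1.
Proof.
by apply: NB_ext (NB_cs S g (t - 4^-1)) => l _; rewrite sn_shift addrA.
Qed.

(** [|f|] is the square root of [1 - (1 - f ^ 2)]. The zeros of [f] fall on the endpoint 1 of the
    square root iteration, where it still converges. *)
Lemma NB_abs S (f : V -> R) : (forall l, S l -> f l ^+ 2 <= 1) ->
  NB S (fun l => (1 - f l ^+ 2)%:C) 1 -> NB S (fun l => (1 - `|f l|)%:C) 1.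
Proof.
move=> f1 H.
have := @NB_sqrt _ _ S (fun l => 1 - f l ^+ 2) 1 _ (lexx _) H.
rewrite subrr sqrtr0 subr0 => K; apply: NB_ext (K _) => l Sl.
  by rewrite subKr sqrtr_sqr.
by rewrite subr_ge0 f1 // lerBlDr lerDl sqr_ge0.
Qed.

Lemma cs_sqr_le1 t : cs t ^+ 2 <= 1.
Proof. by have := cs2Dsn2 t; have := sqr_ge0 (sn t); lra. Qed.

Lemma NB_abs_cs S g t : NB S (fun l => (1 - `|cs (dotp g l + t)|)%:C) 1.
Proof.
apply: NB_abs => [l _|]; first exact: cs_sqr_le1.
have := NB_mul (NB_sn S g t) (NB_sn S g t); rewrite mulr1.
apply: NB_ext => l _; rewrite -rmorphM; congr (_ %:C).
by rewrite -(cs2Dsn2 (dotp g l + t)); ring.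
Qed.

Lemma NB_abs_sn S g t : NB S (fun l => (1 - `|sn (dotp g l + t)|)%:C) 1.
Proof.
apply: NB_ext (NB_abs_cs S g (t - 4^-1)) => l _.
by rewrite sn_shift addrA.
Qed.

(* Once [cos (2 ^ j theta) >= 0] for all [j <= n], the half angle formula takes
   a genuine square root at each step, and each root halves the bound. *)
Lemma NB_one_sub_cs S (th : V -> R) n :
  (forall j, (j <= n)%N -> forall l, S l -> 0 <= cs (2 ^+ j * th l)) ->
  (forall j, NB S (fun l => (sn (2 ^+ j * th l))%:C) 1) ->
  NB S (fun l => (1 - cs (th l))%:C) (2 ^- n).
Proof.
elim: n th => [|n IH] th c0 Hs.
  have : NB S (fun l => (1 - cs (th l) ^+ 2)%:C) 1.
    have := NB_mul (Hs 0%N) (Hs 0%N); rewrite mulr1.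
    apply: NB_ext => l _; rewrite -rmorphM expr0 mul1r; congr (_ %:C).
    by rewrite -(cs2Dsn2 (th l)); ring.
  move/(NB_abs (fun l _ => cs_sqr_le1 _)); rewrite expr0 invr1.
  apply: NB_ext => l Sl; rewrite ger0_norm //.
  by have := c0 0%N isT l Sl; rewrite expr0 mul1r.
have Hx : NB S (fun l => ((1 - cs (2 * th l)) / 2)%:C) (2 ^- n.+1).
  have := NB_cst_mul (2^-1)%:C (IH (fun l => 2 * th l) _ _).
  rewrite cabs_real ger0_norm ?invr_ge0 // => H.
  rewrite exprS invfM; apply: NB_ext (H _ _).
  - by move=> l _; rewrite -rmorphM mulrC.
  - by move=> j jn l Sl; rewrite mulrA -exprSr; apply: c0.
  - move=> j; apply: NB_ext (Hs j.+1) => l _; by rewrite mulrA -exprSr.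
have y1 : (2 : R) ^- n.+1 <= 1.
  by rewrite invf_le1 ?exprn_gt0 // exprn_ege1 // ler1n.
have y0 : 0 <= (2 : R) ^- n.+1 by rewrite invr_ge0 exprn_ge0.
have x01 l : S l -> 0 <= (1 - cs (2 * th l)) / 2 <= 1.
  move=> _; rewrite cs_double; have := cs_sqr_le1 (th l); have := sqr_ge0 (cs (th l)).
  lra.
have H := NB_sqrt x01 y1 Hx.
have : NB S (fun l => (1 - cs (th l))%:C) (1 - Num.sqrt (1 - 2 ^- n.+1)).
  apply: NB_ext H => l Sl.
  have -> : 1 - (1 - cs (2 * th l)) / 2 = cs (th l) ^+ 2 by rewrite cs_double; field.
  rewrite sqrtr_sqr ger0_norm //.
  by have := c0 0%N isT l Sl; rewrite expr0 mul1r.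
apply: NB_le; set y := 2 ^- n.+1 in y0 y1 *.
have w0 := sqrtr_ge0 (1 - y).
have w2 : Num.sqrt (1 - y) ^+ 2 = 1 - y by rewrite sqr_sqrtr // subr_ge0.
move: (Num.sqrt _) w0 w2 => w w0 w2; nra.
Qed.

(** The remainder [E n] satisfies [E (n + 1) = z * E n + n * (z - 1) ^ 2]. This is a discrete Landau
    inequality: with bounded powers of [z] and small [(z - 1) ^ 2], solving for [n * (z - 1)] makes
    [z - 1] small. *)
Lemma NB_landau S (z : V -> C) y n : NB S z 1 ->
  NB S (fun l => (z l - 1) ^+ 2) y ->
  NB S (fun l => z l ^+ n - 1 - n%:R * (z l - 1)) (y * n%:R ^+ 2).
Proof.
move=> Hz H2; have y0 := H2.1; elim: n => [|n IH].
  rewrite expr0n mulr0.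
  have := NB_cst S 0; rewrite cabs0; apply: NB_ext => l _.
  by rewrite expr0 subrr mul0r subr0.
have := NB_add (NB_mul Hz IH) (NB_cst_mul (n%:R%:C) H2).
rewrite mul1r cabs_real ger0_norm ?ler0n // => H.
have {H} := NB_le _ H; move/(_ (y * n.+1%:R ^+ 2)) => H.
apply: NB_ext (H _) => [l _|].
  by rewrite rmorph_nat [z l ^+ n.+1]exprS -[n.+1%:R]natr1; ring.
have n0 : (0 : R) <= n%:R by [].
rewrite -[n.+1%:R]natr1; nra.
Qed.

(** The cosine conditions control only the real part of [z - 1] directly; the imaginary part comes
    through [(z - 1) ^ 2] and [NB_landau]. That [n] precedes [S], [g] and [t] matters, since the
    pieces are later built from [n]. *)
Lemma NB_char_near1 y : 0 < y -> exists n : nat, forall S g (t : R),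
  (forall j, (j <= n)%N -> forall l, S l -> 0 <= cs (2 ^+ j * (dotp g l - t))) ->
  NB S (fun l => cexp2pi (dotp g l - t) - 1) y.
Proof.
move=> y0.
(* The final norm is [(2 + 2 * 2 ^- n * N ^ 2) / N]: [N] brings [2 / N] below [y / 2], then [n] does
   the same for [2 * N * 2 ^- n]. *)
have [N NH] : exists N : nat, 4 / y < N%:R.
  by exists (Num.bound (4 / y)); apply: archi_boundP; rewrite divr_ge0 // ltW.
have [n nH] : exists n : nat, 4 * N%:R / y < n%:R.
  exists (Num.bound (4 * N%:R / y)); apply: archi_boundP.
  by rewrite divr_ge0 ?mulr_ge0 // ltW.
exists n => S g t cH.
have Hz : NB S (fun l => cexp2pi (dotp g l - t)) 1 by exact: NB_shift_char.
have H1 : NB S (fun l => (1 - cs (dotp g l - t))%:C) (2 ^- n).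
  apply: NB_one_sub_cs => // j.
  apply: NB_ext (NB_sn S (2 ^+ j *: g) (2 ^+ j * - t)) => l _.
  by rewrite dotpZl mulrDr.
(* On the unit circle [(z - 1) ^ 2 = - 2 * z * (1 - Re z)]. *)
have H2 : NB S (fun l => (cexp2pi (dotp g l - t) - 1) ^+ 2) (2 * 2 ^- n).
  have := NB_mul (NB_cst_mul (- 2)%:C Hz) H1.
  rewrite cabs_real normrN ger0_norm // mulr1; apply: NB_ext => l _.
  rewrite rmorphB rmorphN /= cs_cexp; have := cexp2piN (dotp g l - t).
  set z := cexp2pi (_ - _); set w := cexp2pi _ => wz.
  have -> : (2^-1)%:C * (z + w) = (2 : C)^-1 * (z + w) by rewrite fmorphV rmorph_nat.
  rewrite rmorph1 rmorph_nat.
  have -> : -2 * z * (1 - 2^-1 * (z + w)) = z ^+ 2 - 2 * z + w * z by field.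
  rewrite wz; ring.
have N0 : 0 < (N%:R : R) by apply: lt_trans NH; rewrite divr_gt0.
have HN : NB S (fun l => cexp2pi (dotp g l - t) ^+ N) 1.
  elim: (N) => [|k IH].
    by have := NB_cst S 1; rewrite cabs1; apply: NB_ext => l _; rewrite expr0.
  by have := NB_mul Hz IH; rewrite mulr1; apply: NB_ext => l _; rewrite exprS.
have := NB_landau N Hz H2 => H3.
have := NB_cst_mul (N%:R^-1)%:C
  (NB_add (NB_add HN (NB_cst S (-1))) (NB_cst_mul (-1) H3)).
rewrite !cabsN cabs1 mul1r cabs_real ger0_norm ?invr_ge0 ?ler0n // => H4.
have {H4} := NB_le _ H4; move/(_ y) => H4.
apply: NB_ext (H4 _) => [l _|].
  rewrite fmorphV rmorph_nat; have NC0 : (N%:R : C) != 0.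
    by rewrite pnatr_eq0 -lt0n -(ltr_nat R).
  by field.
have n2 : (n%:R : R) <= 2 ^+ n by rewrite -natrX ler_nat ltnW // ltn_expl.
have p0 : 0 < (2 : R) ^+ n by rewrite exprn_gt0.
rewrite mulrC ler_pdivrMr //.
have F1 : 4 <= y * N%:R by move: NH; rewrite ltr_pdivrMr // mulrC => /ltW.
have F2 : 4 * N%:R <= y * 2 ^+ n.
  move: nH; rewrite ltr_pdivrMr // mulrC => /ltW /le_trans; apply.
  by rewrite mulrC ler_pM2l.
have F3 : 4 * N%:R * 2 ^- n <= y by rewrite ler_pdivrMr.
set q := 2 ^- n in F3 *; nra.
Qed.

End Localization.

(** * Division by an absolutely convergent sum of characters *)

Section WienerDivision.
Variables (R : realType) (d : nat).
Local Notation V := 'rV[R]_d.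
Local Notation C := R[i].
Implicit Types (S U : set V) (m c : V -> C) (y B : R) (s : seq V) (a : V -> C).
Local Notation "r %:C" := (real_complex R r).
Local Notation NB := bounded_multiplier.

Definition divisible_on c S := exists2 K : R, 0 <= K & forall s a B,
  (forall l, l \in s -> S l) ->
  (forall x, cabs (expsum s (fun l => a l * c l) x) <= B) ->
  forall x, cabs (expsum s a x) <= K * B.

Lemma expsum_filter (p : pred V) s a x : (forall l, ~~ p l -> a l = 0) ->
  expsum [seq l <- s | p l] a x = expsum s a x.
Proof.
move=> H; rewrite /expsum big_filter big_mkcond; apply: eq_bigr => l _.
by case: ifPn => // /H ->; rewrite mul0r.
Qed.

(** Multiplication by [M i] commutes with multiplication by [c], so the bound on the sum with
    coefficients [a l * c l] passes to each piece, and there only the frequencies with [M i l != 0]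
    remain. *)
Lemma divisible_partition c S (I : finType) (M : I -> V -> C) :
  (forall i, exists y, NB S (M i) y) ->
  (forall i, divisible_on c [set l | S l /\ M i l != 0]) ->
  (forall l, S l -> \sum_i M i l = 1) -> divisible_on c S.
Proof.
move=> HM HD H1.
have [y yH] := choice HM.
have /choice[K KH] : forall i, exists k, 0 <= k /\ forall s a B,
    (forall l, l \in s -> S l /\ M i l != 0) ->
    (forall x, cabs (expsum s (fun l => a l * c l) x) <= B) ->
    forall x, cabs (expsum s a x) <= k * B.
  by move=> i; have [k k0 kH] := HD i; exists k.
exists (\sum_i K i * y i) => [|s a B sS aB x].
  by apply: sumr_ge0 => i _; rewrite mulr_ge0 // ?(KH i).1 // (yH i).1.
have -> : expsum s a x = \sum_i expsum s (fun l => a l * M i l) x.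
  rewrite /expsum exchange_big; apply: eq_big_seq => l ls /=.
  by rewrite -mulr_suml -mulr_sumr H1 ?mulr1 //; exact: sS.
apply: (le_trans (cabs_sum _ _)); rewrite mulr_suml; apply: ler_sum => i _.
rewrite -mulrA -(@expsum_filter (fun l => M i l != 0)); last first.
  by move=> l /negbNE /eqP ->; rewrite mulr0.
apply: (KH i).2 => [l|x'].
  by rewrite mem_filter => /andP[Ml /sS Sl].
rewrite expsum_filter; last by move=> l /negbNE /eqP ->; rewrite mulr0 mul0r.
rewrite (@eq_expsum _ _ _ _ (fun l => (a l * c l) * M i l)); last first.
  by move=> l _; rewrite mulrAC.
exact: (yH i).2.
Qed.

(** Positive part of [t] for [b = false], negative part for [b = true]. *)
Definition half_wave (b : bool) (t : R) : R := (`|t| + (-1) ^+ b * t) / 2.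

Lemma half_wave_neq0 b t : half_wave b t != 0 -> 0 < (-1) ^+ b * t.
Proof.
rewrite /half_wave; apply: contraR; rewrite -leNgt => H.
suff -> : `|t| = - ((-1) ^+ b * t) by rewrite addNr mul0r.
rewrite -ler0_norm // normrM normrX normrN normr1 expr1n mul1r //.
Qed.

Lemma half_wave_sqr t : half_wave false t ^+ 2 + half_wave true t ^+ 2 = t ^+ 2.
Proof.
have : `|t| ^+ 2 = t ^+ 2 by rewrite real_normK ?num_real.
rewrite /half_wave expr0 expr1; move: `|t| => n nE.
have -> : ((n + 1 * t) / 2) ^+ 2 + ((n + -1 * t) / 2) ^+ 2 = (n ^+ 2 + t ^+ 2) / 2.
  by field.
by rewrite nE; field.
Qed.

Lemma NB_half_wave S b (f : V -> R) : NB S (fun l => (f l)%:C) 1 ->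
  NB S (fun l => (1 - `|f l|)%:C) 1 -> exists y, NB S (fun l => (half_wave b (f l))%:C) y.
Proof.
move=> H1 H2; have H := NB_cst_mul (2^-1)%:C
  (NB_add (NB_add (NB_cst S 1) (NB_cst_mul (-1) H2)) (NB_cst_mul ((-1) ^+ b) H1)).
eexists; apply: NB_ext H.
move=> l _ /=; rewrite /half_wave.
rewrite -(rmorph1 (real_complex R)) -rmorphN -rmorphXn -!rmorphM -!rmorphD -!rmorphM.
by congr (_ %:C); field.
Qed.

(* The two phases [0] and [1 / 8] turn [4 * cos ^ 2 * sin ^ 2] into
   [sin ^ 2] and [cos ^ 2] of the double angle, which add up to [1]. *)
Definition quadrant (g : V) (i : bool * bool * bool) (l : V) : C :=
  let t := dotp g l + i.1.1%:R / 8 in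
  (4 * (half_wave i.1.2 (cs t) ^+ 2 * half_wave i.2 (sn t) ^+ 2))%:C.

Lemma sum_quadrant g l : \sum_i quadrant g i l = 1.
Proof.
rewrite /quadrant -(pair_big xpredT xpredT (fun (i : bool * bool) (j : bool) =>
  (4 * (half_wave i.2 (cs (dotp g l + i.1%:R / 8)) ^+ 2 *
        half_wave j (sn (dotp g l + i.1%:R / 8)) ^+ 2))%:C)) /=.
rewrite -(pair_big xpredT xpredT (fun (i j : bool) => \sum_(k : bool)
  (4 * (half_wave j (cs (dotp g l + i%:R / 8)) ^+ 2 *
        half_wave k (sn (dotp g l + i%:R / 8)) ^+ 2))%:C)) /=.
have E (t : R) : \sum_(j : bool) \sum_(k : bool)
   (4 * (half_wave j (cs t) ^+ 2 * half_wave k (sn t) ^+ 2))%:C = (sn (2 * t) ^+ 2)%:C.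
  rewrite !big_bool /= -!rmorphD; congr (_ %:C).
  rewrite sn_double [RHS]exprMn [(2 * cs t) ^+ 2]exprMn -(half_wave_sqr (cs t)) -(half_wave_sqr (sn t)).
  move: (half_wave true (cs t)) (half_wave false (cs t)) (half_wave true (sn t))
    (half_wave false (sn t)) => p q u v.
  by ring.
rewrite big_bool /= !E mul0r addr0 mul1r.
have -> : 2 * (dotp g l + 8^-1) = 2 * dotp g l + 4^-1 by field.
by rewrite -cs_shift -rmorphD cs2Dsn2.
Qed.

Lemma NB_quadrant S g i : exists y, NB S (quadrant g i) y.
Proof.
have [y1 H1] := NB_half_wave i.1.2 (NB_cs S g (i.1.1%:R / 8)) (NB_abs_cs S g _).
have [y2 H2] := NB_half_wave i.2 (NB_sn S g (i.1.1%:R / 8)) (NB_abs_sn S g _).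
have H := NB_cst_mul 4%:C (NB_mul (NB_mul H1 H1) (NB_mul H2 H2)).
eexists; apply: NB_ext H.
by move=> l _; rewrite -!rmorphM -!expr2.
Qed.

(** On one piece the shifted phase has a sine and a cosine of fixed strict sign, so two phases share
    an open quadrant and differ by less than a quarter turn. *)
Lemma quadrant_cs g i l l' : quadrant g i l != 0 -> quadrant g i l' != 0 ->
  0 <= cs (dotp g l - dotp g l').
Proof.
have E k : quadrant g i k != 0 -> let t := dotp g k + i.1.1%:R / 8 in
    0 < (-1) ^+ i.1.2 * cs t /\ 0 < (-1) ^+ i.2 * sn t.
  move=> H t; suff [/half_wave_neq0 ? /half_wave_neq0 ?] :
    half_wave i.1.2 (cs t) != 0 /\ half_wave i.2 (sn t) != 0 by [].
  by split; apply: contra_neq H => H; rewrite /quadrant -/t H expr0n ?(mul0r, mulr0).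
move=> /E[c1 s1] /E[c2 s2].
have -> : dotp g l - dotp g l' =
  dotp g l + i.1.1%:R / 8 - (dotp g l' + i.1.1%:R / 8) by ring.
rewrite csB addr_ge0 //.
  have := mulr_gt0 c1 c2; rewrite mulrACA -expr2 sqrr_sign mul1r; exact: ltW.
have := mulr_gt0 s1 s2; rewrite mulrACA -expr2 sqrr_sign mul1r; exact: ltW.
Qed.

(** Each [g] in [G] refines the current set into the eight supports of [quadrant g]; bounds already
    known for earlier [g] survive the passage to subsets. *)
Lemma divisible_localize c (G : seq V) S :
  (forall S', S' `<=` S ->
     (forall g, g \in G -> forall l l', S' l -> S' l' -> 0 <= cs (dotp g l - dotp g l')) ->
     divisible_on c S') ->
  divisible_on c S.
Proof.
elim: G S => [|g G IH] S H; first exact: H.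
apply: (@divisible_partition _ _ _ (quadrant g)) => [i|i|l _].
- exact: NB_quadrant.
- apply: IH => S' SS' HG; apply: H => [l /SS' [] //|g'].
  rewrite inE => /orP[/eqP -> l l' /SS' [_ Hl] /SS' [_ Hl']|]; last exact: HG.
  exact: quadrant_cs Hl Hl'.
- exact: sum_quadrant.
Qed.

Lemma NB_sum S (I : Type) (r : seq I) (M : I -> V -> C) (y : I -> R) :
  (forall i, NB S (M i) (y i)) ->
  NB S (fun l => \sum_(i <- r) M i l) (\sum_(i <- r) y i).
Proof.
move=> H; elim: r => [|i r IH].
  have := NB_cst S 0; rewrite cabs0 big_nil; apply: NB_ext => l _; by rewrite big_nil.
rewrite big_cons; apply: NB_ext (NB_add (H i) IH) => l _; by rewrite big_cons.
Qed.

Lemma exists_small_tail (Gam : set V) (w : V -> C) (A e : R) : 0 < e ->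
  (forall F, uniq F -> (forall g, g \in F -> Gam g) -> \sum_(g <- F) cabs (w g) <= A) ->
  exists F0, [/\ uniq F0, (forall g, g \in F0 -> Gam g) &
    forall F, uniq F -> (forall g, g \in F -> Gam g /\ g \notin F0) ->
      \sum_(g <- F) cabs (w g) <= e].
Proof.
move=> e0 HA.
pose X := [set r : R | exists F, [/\ uniq F, (forall g, g \in F -> Gam g) &
  r = \sum_(g <- F) cabs (w g)]].
have X0 : has_sup X.
  split; first by exists 0, [::]; rewrite big_nil.
  by exists A => r [F [uF FG ->]]; exact: HA.
have [_ [F0 [u0 G0 ->]] H] := sup_adherent e0 X0.
exists F0; split => // F uF FG.
have : \sum_(g <- F0 ++ F) cabs (w g) <= sup X.
  apply: sup_upper_bound => //; exists (F0 ++ F); split => //.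
    rewrite cat_uniq u0 uF andbT /=; apply/hasPn => g /FG []//.
  by move=> g; rewrite mem_cat => /orP[/G0|/FG []].
rewrite big_cat /=; lra.
Qed.

Lemma has_sum_seq (A : set V) (w : V -> C) (ch : V -> V -> C) c s e : 0 < e ->
  (forall l, l \in s -> has_sum A (fun g => w g * ch g l) (c l)) ->
  exists F, [/\ uniq F, (forall g, g \in F -> A g) &
    forall F', uniq F' -> (forall g, g \in F' -> A g) -> {subset F <= F'} ->
      forall l, l \in s -> cabs (\sum_(g <- F') w g * ch g l - c l) < e].
Proof.
move=> e0; elim: s => [|l s IH] H; first by exists [::].
have [F1 [u1 A1 H1]] := IH (fun l' Hl => H l' (mem_behead (s := l :: s) Hl)).
have [F2 [u2 A2 H2]] := H l (mem_head _ _) _ e0.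
exists (undup (F1 ++ F2)); split.
- exact: undup_uniq.
- by move=> g; rewrite mem_undup mem_cat => /orP[/A1|/A2].
- move=> F' uF FA sub l'; rewrite inE => /orP[/eqP ->|ls].
    by apply: H2 => // g gF; apply: sub; rewrite mem_undup mem_cat gF orbT.
  by apply: H1 => // g gF; apply: sub; rewrite mem_undup mem_cat gF.
Qed.

(** On a piece with base point [l0], the multiplier [c - c l0] has norm at most [eps / 2] while
    [c l0] has modulus at least [eps]. Hence [c l0] times a sum is its product with [c] up to an
    error of half its size, which is absorbed. *)
Theorem wiener_division (U Gam : set V) (w c : V -> C) (A eps : R) :
  0 < eps ->
  (forall F, uniq F -> (forall g, g \in F -> Gam g) -> \sum_(g <- F) cabs (w g) <= A) ->
  (forall l, U l -> has_sum Gam (fun g => w g * cexp2pi (dotp g l)) (c l)) ->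
  (forall l, U l -> eps <= cabs (c l)) ->
  divisible_on c U.
Proof.
move=> eps0 HA Hc ceps.
have A0 : 0 <= A by have := HA [::] isT; rewrite big_nil; apply.
(* Budget [eps / 2]: a character minus a constant of modulus 1 has norm at most 2, so the tail costs
   [2 * (eps / 8)], and the head costs at most [k * A <= eps / 4]. *)
have [F0 [u0 G0 tail]] := exists_small_tail (divr_gt0 eps0 (ltr0n R 8)) HA.
have k0 : 0 < eps / (4 * (A + 1)) by rewrite divr_gt0 // mulr_gt0 // ltr_wpDl.
have [n nH] := NB_char_near1 d k0; set k := eps / _ in k0 nH.
have kA : k * A <= eps / 4.
  have E : k * (4 * (A + 1)) = eps by rewrite /k divfK // gt_eqF // mulr_gt0 // ltr_wpDl.
  nra.
(* Localizing also at the dyadic multiples of [g] yields the cosine signs that the repeated half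
   angle formula asks for. *)
apply: (@divisible_localize _ [seq 2 ^+ j *: g | g <- F0, j <- iota 0 n.+1]).
move=> S SU HG.
(* A piece without a base point carries only the zero sum. *)
case: (pselect (exists l0, S l0)) => [[l0 Sl0]|S0]; last first.
  exists 0 => // s a B sS _ x; case: s sS => [|l s] sS.
    by rewrite /expsum big_nil cabs0 mul0r.
  by case: S0; exists l; apply: sS; rewrite mem_head.
have near1 g : g \in F0 -> NB S (fun l => cexp2pi (dotp g l - dotp g l0) - 1) k.
  move=> gF; apply: nH => j jn l Sl; rewrite mulrBr -!dotpZl; apply: HG => //.
  by apply/allpairsP; exists (g, j); rewrite mem_iota.
have HD : NB S (fun l => c l - c l0) (eps / 2).
  apply: NB_lim => [|s e sS e0]; first by rewrite divr_ge0 // ltW.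
  have e20 : 0 < e / 2 by rewrite divr_gt0.
  have [|F1 [u1 G1 H1]] := @has_sum_seq Gam w (fun g l => cexp2pi (dotp g l)) c (l0 :: s) _ e20.
    by move=> l; rewrite inE => /orP[/eqP ->|/sS ?]; apply: Hc; apply: SU.
  pose F := F0 ++ [seq g <- F1 | g \notin F0].
  have uF : uniq F.
    rewrite cat_uniq u0 filter_uniq // andbT; apply/hasPn => g.
    by rewrite mem_filter => /andP[].
  have FG g : g \in F -> Gam g.
    by rewrite mem_cat mem_filter => /orP[/G0|/andP[_ /G1]].
  have FF : {subset F1 <= F}.
    by move=> g gF; rewrite mem_cat mem_filter gF andbT orbN.
  exists (fun l => \sum_(g <- F) w g * (cexp2pi (dotp g l) - cexp2pi (dotp g l0))).
    have Hw g : NB S (fun l => w g * (cexp2pi (dotp g l) - cexp2pi (dotp g l0)))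
        (cabs (w g) * (if g \in F0 then k else 2)).
      have E l : cexp2pi (dotp g l) - cexp2pi (dotp g l0) =
          cexp2pi (dotp g l0) * (cexp2pi (dotp g l - dotp g l0) - 1).
        by rewrite mulrBr mulr1 -cexp2piD [dotp g l0 + _]addrC subrK.
      apply: NB_cst_mul; case: ifP => gF.
        have := NB_cst_mul (cexp2pi (dotp g l0)) (near1 g gF).
        by rewrite cabs_cexp2pi mul1r; apply: NB_ext => l _; rewrite E.
      have := NB_add (NB_char S g) (NB_cst S (- cexp2pi (dotp g l0))).
      by rewrite cabsN cabs_cexp2pi.
    apply: NB_le (NB_sum F Hw).
    rewrite big_cat /= (eq_big_seq (fun g => k * cabs (w g))); last first.
      by move=> g gF; rewrite gF mulrC.
    rewrite [X in _ + X](eq_big_seq (fun g => 2 * cabs (w g))); last first.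
      by move=> g; rewrite mem_filter => /andP[/negbTE -> _]; rewrite mulrC.
    rewrite -!mulr_sumr.
    have T1 : \sum_(g <- F0) cabs (w g) <= A by exact: HA.
    have T2 : \sum_(g <- [seq g <- F1 | g \notin F0]) cabs (w g) <= eps / 8.
      apply: tail => [|g]; first exact: filter_uniq.
      by rewrite mem_filter => /andP[? /G1].
    have T3 : k * \sum_(g <- F0) cabs (w g) <= k * A by rewrite ler_pM2l.
    lra.
  move=> l ls.
  have E1 := H1 F uF FG FF l (mem_behead (s := l0 :: s) ls).
  have E2 := H1 F uF FG FF l0 (mem_head _ _).
  under [X in _ - X]eq_bigr do rewrite mulrBr.
  rewrite sumrB.
  set p := \sum_(g <- F) _ in E1 *; set q := \sum_(g <- F) _ in E2 *.
  have -> : c l - c l0 - (p - q) = (q - c l0) - (p - c l) by ring.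
  apply: (le_trans (cabsB _ _)); lra.
exists (2 / eps) => [|s a B sS aB x]; first by rewrite divr_ge0 // ltW.
have -> : 2 / eps * B = 2 * (B / eps) by rewrite mulrAC -mulrA.
move: x; apply: (half_contraction_bound (expsum_bounded s a)) => M aM x.
have H := HD.2 s a M sS aM x.
have E : expsum s (fun l => a l * (c l - c l0)) x =
   expsum s (fun l => a l * c l) x - c l0 * expsum s a x.
  rewrite -mulNr -expsumZ -expsumD; apply: eq_expsum => l _; ring.
have H2 : cabs (c l0 * expsum s a x) <= B + eps / 2 * M.
  have -> : c l0 * expsum s a x = expsum s (fun l => a l * c l) x -
    (expsum s (fun l => a l * c l) x - c l0 * expsum s a x) by ring.
  by apply: (le_trans (cabsB _ _)); rewrite -E lerD.
rewrite cabsM in H2.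
have H3 : eps * cabs (expsum s a x) <= B + eps / 2 * M.
  by apply: le_trans H2; rewrite ler_wpM2r ?cabs_ge0 // ceps //; apply: SU.
rewrite -(ler_pM2l eps0); apply: (le_trans H3).
by rewrite mulrDr mulrCA mulfV ?gt_eqF // mulr1 mulrA mulrAC.
Qed.

End WienerDivision.

(** * Band-limited Schwartz functions *)

Section DerivativeRules.
Variable R : realType.
Implicit Types (f g : R -> R) (x a b : R).

Lemma is_derive_mul f g x a b : is_derive x 1 f a -> is_derive x 1 g b ->
  is_derive x 1 (fun t => f t * g t) (a * g x + f x * b).
Proof.
move=> Hf Hg; have := is_deriveM Hf Hg.
by rewrite addrC /GRing.scale /= [g x * a]mulrC.
Qed.

Lemma is_derive_add f g x a b : is_derive x 1 f a -> is_derive x 1 g b ->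
  is_derive x 1 (fun t => f t + g t) (a + b).
Proof. by move=> Hf Hg; have := is_deriveD Hf Hg. Qed.

Lemma is_derive_opp f x a : is_derive x 1 f a -> is_derive x 1 (fun t => - f t) (- a).
Proof. by move=> Hf; have := is_deriveN Hf. Qed.

Lemma is_derive_comp1 f g x a b : is_derive (g x) 1 f a -> is_derive x 1 g b ->
  is_derive x 1 (fun t => f (g t)) (a * b).
Proof. by move=> Hf Hg; have := is_derive1_comp Hf Hg. Qed.

Lemma is_derive_exprn f x a n : is_derive x 1 f a ->
  is_derive x 1 (fun t => f t ^+ n.+1) (n.+1%:R * f x ^+ n * a).
Proof.
move=> Hf; have -> : (fun t => f t ^+ n.+1) = f ^+ n.+1.
  by apply/funext => t; rewrite exprfctE.
by have := is_deriveX n.+1 Hf; apply.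
Qed.

Lemma is_derive_inv f x a : f x != 0 -> is_derive x 1 f a ->
  is_derive x 1 (fun t => (f t)^-1) (- (f x) ^- 2 * a).
Proof. by move=> f0 Hf; have := is_deriveV f0 Hf. Qed.

Lemma is_derive_affine (c e : R) x : is_derive x 1 (fun t => c * t + e) c.
Proof.
have := is_derive_add (is_derive_mul (is_derive_cst c x 1) (is_derive_id x 1))
  (is_derive_cst e x 1).
by rewrite mul0r add0r mulr1 addr0.
Qed.

Lemma is_derive_continuous f x a : is_derive x 1 f a -> {for x, continuous f}.
Proof. by move=> [H _]; exact/differentiable_continuous/derivable1_diffP. Qed.

Lemma is_derive_val f x a : is_derive x 1 f a -> f^`() x = a.
Proof. by move=> H; rewrite derive1E; exact: derive_val. Qed.

(** Meant for the endpoints of the bump, around which no single formula holds. *)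
Lemma is_derive_quadratic f x a K :
  (forall t, `|t - x| < 1 -> `|f t - f x - a * (t - x)| <= K * (t - x) ^+ 2) ->
  is_derive x 1 f a.
Proof.
move=> H.
have K0 : 0 <= `|K| + 1 by rewrite addr_ge0.
have L : h^-1 *: (f (h *: (1 : R) + x) - f x) @[h --> 0^'] --> a.
  apply/cvgrPdist_le => e e0.
  near=> h.
  have h0 : h != 0 by near: h; exact: nbhs_dnbhs_neq.
  have h1 : `|h| < 1 by near: h; apply: dnbhs0_lt.
  have h2 : `|h| < e / (`|K| + 1).
    by near: h; apply: dnbhs0_lt; rewrite divr_gt0 // ltr_wpDl.
  rewrite /GRing.scale /= mulr1 distrC.
  have := H (h + x); rewrite addrK => /(_ h1) Hh.
  have hp : 0 < `|h| by rewrite normr_gt0.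
  rewrite -(ler_pM2l hp) -normrM mulrBr mulrA mulfV // mul1r [h * a]mulrC.
  apply: (le_trans Hh).
  rewrite -[h ^+ 2]real_normK ?num_real //.
  have KK := ler_norm K.
  have E : `|h| * (`|K| + 1) <= e by rewrite -ler_pdivlMr ?ltr_wpDl // ltW.
  have nh := normr_ge0 h; nra.
by apply: DeriveDef; [apply/cvg_ex; exists a | apply/cvg_lim].
Unshelve. all: by end_near. Qed.

Lemma near_is_derive f g x a : (\forall t \near x, f t = g t) ->
  is_derive x 1 f a -> is_derive x 1 g a.
Proof. by move=> fg; apply: near_eq_is_derive; rewrite ?oner_neq0. Qed.

End DerivativeRules.

(** * A family of smooth bumps closed under differentiation *)

Section Bump.
Variable R : realType.
Variables a b : R.
Hypothesis ab : 0 < a < `|b|.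

(* Smooth functions supported in [-1, 1]; the factor [(a u + b)^-1] makes the
   family stable under division by the frequency [a u + b]. *)
Definition smooth_bump (p : {poly R}) (k j : nat) (u : R) : R :=
  if `|u| < 1 then
    p.[u] * (1 - u ^+ 2)^-1 ^+ k.+1 * (a * u + b)^-1 ^+ j.+1 * expR (- (1 - u ^+ 2)^-1)
  else 0.

Lemma freq_ge (u : R) : `|u| <= 1 -> `|b| - a <= `|a * u + b|.
Proof.
move=> u1; have /andP[a0 _] := ab.
have : `|a * u| <= a by rewrite normrM gtr0_norm // ger_pMr.
have := ler_normB (a * u + b) (a * u); rewrite addrAC subrr add0r; lra.
Qed.

Lemma freq_neq0 (u : R) : `|u| <= 1 -> a * u + b != 0.
Proof.
move=> /freq_ge; have /andP[_ ?] := ab; rewrite -normr_gt0 => ?; lra.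
Qed.

Lemma one_sub_sqr_gt0 (u : R) : `|u| < 1 -> 0 < 1 - u ^+ 2.
Proof. by move=> u1; rewrite subr_gt0 -[u ^+ 2]real_normK ?num_real // expr_lt1. Qed.

(** With [v = (1 - u ^ 2)^-1], the exponential series gives [v ^ (k + 3) <= (k + 3)! * exp v]. The
    two powers beyond [k + 1] provide the quadratic vanishing at the endpoints. *)
Lemma bump_decay p k j : exists M, forall u, `|smooth_bump p k j u| <= M * (1 - u ^+ 2) ^+ 2.
Proof.
have /andP[a0 ab'] := ab.
pose M := (\sum_(i < size p) `|p`_i|) * (`|b| - a)^-1 ^+ j.+1 * (k.+3)`!%:R.
exists M => u; rewrite /smooth_bump; case: ifPn => u1; last first.
  rewrite normr0 mulr_ge0 ?sqr_ge0 // /M !mulr_ge0 ?sumr_ge0 ?exprn_ge0 ?invr_ge0 //.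
  by rewrite subr_ge0 ltW.
have s0 := one_sub_sqr_gt0 u1.
set s := 1 - u ^+ 2 in s0 *.
have v0 : 0 < s^-1 by rewrite invr_gt0.
rewrite !normrM [`|expR _|]ger0_norm ?expR_ge0 // expRN.
have P1 : `|p.[u]| <= \sum_(i < size p) `|p`_i|.
  rewrite horner_coef (le_trans (ler_norm_sum _ _ _)) //; apply: ler_sum => i _.
  by rewrite normrM ler_piMr // normrX exprn_ile1 // ltW.
have P2 : `|(a * u + b)^-1 ^+ j.+1| <= (`|b| - a)^-1 ^+ j.+1.
  rewrite normrX lerXn2r ?nnegrE ?invr_ge0 ?subr_ge0 ?(ltW ab') //.
  rewrite normfV lef_pV2 ?posrE ?subr_gt0 ?normr_gt0 ?freq_neq0 ?(ltW u1) //.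
  by rewrite freq_ge // ltW.
have P3 : `|s^-1 ^+ k.+1| * (expR s^-1)^-1 <= (k.+3)`!%:R * s ^+ 2.
  rewrite normrX ger0_norm ?(ltW v0) // ler_pdivrMr ?expR_gt0 //.
  have F : s^-1 ^+ k.+3 <= (k.+3)`!%:R * expR s^-1.
    have := expR_ge1Dxn k.+2 (ltW v0) => H.
    have f0 : 0 < (k.+3)`!%:R :> R by rewrite ltr0n fact_gt0.
    rewrite mulrC -ler_pdivrMr //; lra.
  have -> : s^-1 ^+ k.+1 = s^-1 ^+ k.+3 * s ^+ 2.
    rewrite -(addn2 k.+1) exprD -mulrA -exprMn mulVf ?expr1n ?mulr1 // gt_eqF //.
  by rewrite [leRHS]mulrAC ler_wpM2r // sqr_ge0.
have -> : `|p.[u]| * `|s^-1 ^+ k.+1| * `|(a * u + b)^-1 ^+ j.+1| * (expR s^-1)^-1 =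
  (`|p.[u]| * `|(a * u + b)^-1 ^+ j.+1|) * (`|s^-1 ^+ k.+1| * (expR s^-1)^-1) by ring.
rewrite /M -[leRHS]mulrA; apply: ler_pM => //; exact: ler_pM.
Qed.

(** Numerator of the derivative over the common denominator [(1 - u ^ 2) ^ (k + 3) * (a * u + b) ^
    (j + 2)]; the last two terms come from the power of [1 - u ^ 2] and from the exponential. *)
Definition dsmooth_bump (p : {poly R}) (k j : nat) : {poly R} :=
  (p^`() * (a *: 'X + b%:P) - (j.+1%:R * a) *: p) * (1%:P - 'X ^+ 2) ^+ 2 +
  (k.+1%:R * 2) *: ('X * p * (1%:P - 'X ^+ 2) * (a *: 'X + b%:P)) -
  2 *: ('X * p * (a *: 'X + b%:P)).

Lemma is_derive_bump p k j (u : R) :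
  is_derive u 1 (smooth_bump p k j) (smooth_bump (dsmooth_bump p k j) k.+2 j.+1 u).
Proof.
case: (ltrgtP `|u| 1) => u1.
- have s0 := one_sub_sqr_gt0 u1.
  have s1 : 1 - u ^+ 2 != 0 by rewrite gt_eqF.
  have z1 := freq_neq0 (ltW u1).
  have D1 : is_derive u 1 (fun t : R => (1 - t ^+ 2)^-1) (2 * u * (1 - u ^+ 2)^-1 ^+ 2).
    have D0 := is_derive_add (is_derive_cst (1 : R) u 1)
      (is_derive_opp (is_derive_exprn 1 (is_derive_id u 1))).
    have := is_derive_inv (f := fun t : R => 1 + - t ^+ 2) s1 D0.
    by move/is_derive_eq; apply; rewrite expr1 mulr1; field.
  have D2 : is_derive u 1 (fun t => (a * t + b)^-1) (- a * (a * u + b)^-1 ^+ 2).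
    have := is_derive_inv (f := fun t : R => a * t + b) z1 (is_derive_affine a b u).
    by move/is_derive_eq; apply; field.
  have D := is_derive_mul (is_derive_mul (is_derive_mul (is_derive_poly p u)
    (is_derive_exprn k D1)) (is_derive_exprn j D2))
    (is_derive_comp1 (is_derive_expR _) (is_derive_opp D1)).
  have N : \forall t \near u, p.[t] * (1 - t ^+ 2)^-1 ^+ k.+1 * (a * t + b)^-1 ^+ j.+1 *
     expR (- (1 - t ^+ 2)^-1) = smooth_bump p k j t.
    have : \forall t \near u, `|t| < 1.
      by have := cvgr_lt _ (@norm_continuous _ R u); apply.
    by apply: filterS => t t1; rewrite /smooth_bump t1.
  apply: near_is_derive N _; apply: (is_derive_eq D).
  rewrite /smooth_bump u1 /dsmooth_bump !(hornerD, hornerN, hornerZ, hornerM, horner_exp, hornerX, hornerC).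
  rewrite [_ ^+ k.+3]exprSr [_ ^+ k.+2]exprSr [_ ^+ k.+1]exprSr [_ ^+ j.+2]exprSr
    [_ ^+ j.+1]exprSr /=.
  move: (_ ^-1 ^+ k) (_ ^-1 ^+ j) (expR _) => A B e.
  field.
  by rewrite s1 z1.
- have N : \forall t \near u, 0 = smooth_bump p k j t.
    have : \forall t \near u, 1 < `|t|.
      by have := cvgr_gt _ (@norm_continuous _ R u); apply.
    by apply: filterS => t t1; rewrite /smooth_bump ltNge (ltW t1).
  have -> : smooth_bump (dsmooth_bump p k j) k.+2 j.+1 u = 0 by rewrite /smooth_bump ltNge (ltW u1).
  exact: (near_is_derive (f := cst 0) N (is_derive_cst _ _ _)).
(* At an endpoint [1 - t ^ 2 = - (t - u) * (t + u)], and [|t + u| <= 3] for [t] within distance 1 of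
   [u]; hence the factor 9. *)
- have [M MH] := bump_decay p k j.
  have u2 : u ^+ 2 = 1 by rewrite -[u ^+ 2]real_normK ?num_real // u1 expr1n.
  have -> : smooth_bump (dsmooth_bump p k j) k.+2 j.+1 u = 0 by rewrite /smooth_bump u1 ltxx.
  apply: (@is_derive_quadratic _ _ _ _ (`|M| * 9)) => t tu.
  have -> : smooth_bump p k j u = 0 by rewrite /smooth_bump u1 ltxx.
  rewrite subr0 mul0r subr0; apply: (le_trans (MH t)).
  have -> : 1 - t ^+ 2 = - (t - u) * (t + u) by rewrite -u2; ring.
  rewrite exprMn sqrrN mulrCA [leRHS]mulrC.
  apply: ler_wpM2l; first exact: sqr_ge0.
  apply: (le_trans (ler_norm _)); rewrite normrM ler_wpM2l //.
  rewrite ger0_norm ?sqr_ge0 // -[_ ^+ 2]real_normK ?num_real //.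
  have : `|t + u| <= 3.
    have -> : t + u = (t - u) + 2 * u by ring.
    apply: (le_trans (ler_normD _ _)); rewrite normrM u1 mulr1 ger0_norm //; lra.
  have := normr_ge0 (t + u); nra.
Qed.

Lemma bump_continuous p k j : continuous (smooth_bump p k j).
Proof. by move=> u; apply: is_derive_continuous (is_derive_bump p k j u). Qed.

Lemma bumpM p q k j u : smooth_bump (p * q) k j u = p.[u] * smooth_bump q k j u.
Proof. by rewrite /smooth_bump; case: ifP => _; rewrite ?mulr0 // hornerM; ring. Qed.

Lemma bump_freq p k j u : smooth_bump p k j u = (a * u + b) * smooth_bump p k j.+1 u.
Proof.
rewrite /smooth_bump; case: ifP => u1; last by rewrite mulr0.
have := freq_neq0 (ltW u1) => z1.
rewrite [_ ^+ j.+2]exprS; move: (_ ^+ j.+1) => w; by field.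
Qed.

Lemma bump_endpoint p k j u : 1 <= `|u| -> smooth_bump p k j u = 0.
Proof. by rewrite /smooth_bump ltNge => ->. Qed.

End Bump.

(** * Integrals over the real line *)

Section RealLine.
Variable R : realType.
Let mu := @lebesgue_measure R.
Implicit Types (f F : R -> R).

Lemma integrable_itv f (x y : R) : continuous f ->
  mu.-integrable `[x, y] (EFin \o f).
Proof.
move=> cf; apply: continuous_compact_integrable; first exact: segment_compact.
exact: continuous_subspaceT.
Qed.

Lemma integrable_oneDsqrV : mu.-integrable setT (EFin \o (fun x : R => (1 + x ^+ 2)^-1)).
Proof.
have c0 : continuous (fun x : R => (1 + x ^+ 2)^-1) by exact: continuous_oneDsqrV.
have p0 (x : R) : 0 <= (1 + x ^+ 2)^-1 by rewrite invr_ge0 addr_ge0 // sqr_ge0.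
apply/integrableP; split.
  by apply/measurable_EFinP; exact: continuous_measurable_fun.
under eq_integral do rewrite /= ger0_norm //.
rewrite ge0_symfun_integralT //; last by move=> x /=; rewrite sqrrN.
have -> : [set x : R | 0 <= x] = `[0%R, +oo[%classic by rewrite set_itvcy.
by rewrite (integral0y_oneDsqr R) -EFinM ltry.
Qed.

Lemma integrable_decay f (M : R) : continuous f ->
  (forall x, (1 + x ^+ 2) * `|f x| <= M) -> mu.-integrable setT (EFin \o f).
Proof.
move=> cf fM.
have := integrableZl measurableT M integrable_oneDsqrV => H.
apply: (le_integrable _ _ _ H) => //.
  by apply/measurable_EFinP; exact: continuous_measurable_fun.
move=> x _ /=; rewrite lee_fin.
have p0 : 0 < 1 + x ^+ 2 by rewrite ltr_wpDr // sqr_ge0.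
rewrite [leRHS]ger0_norm; first by rewrite ler_pdivlMr // mulrC.
rewrite divr_ge0 ?(ltW p0) //; apply: le_trans (fM x).
by rewrite mulr_ge0 // ltW.
Qed.

(** The fundamental theorem on [[-(n + 1), n + 1]], nondegenerate even for [n = 0], leaves boundary
    values that tend to 0; dominated convergence by [|f|] does the rest. *)
Lemma Rintegral_derive_eq0 f F : continuous f -> mu.-integrable setT (EFin \o f) ->
  (forall x, is_derive (x : R) 1 F (f x)) ->
  (exists M, forall x, (1 + `|x|) * `|F x| <= M) ->
  \int[mu]_x f x = 0.
Proof.
move=> cf intf dF [M FM].
pose g (n : nat) := f \_ `[- n.+1%:R, n.+1%:R].
have I n : (\int[mu]_x (g n x)%:E = (F n.+1%:R)%:E - (F (- n.+1%:R))%:E)%E.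
  have -> : (fun x => (g n x)%:E) = (EFin \o f) \_ `[- n.+1%:R, n.+1%:R].
    by apply/funext => x; rewrite /g !patchE; case: ifP.
  rewrite -integral_mkcond.
  rewrite (@continuous_FTC2 _ f F) //.
  - by rewrite ltrN2 || (rewrite (lt_trans (y := 0)) ?oppr_lt0 ?ltr0n).
  - exact: continuous_subspaceT.
  - split=> [x _||]; first by have [] := dF x.
      by apply: cvg_at_right_filter; exact: (is_derive_continuous (dF _)).
    by apply: cvg_at_left_filter; exact: (is_derive_continuous (dF _)).
  - by move=> x _; exact: is_derive_val (dF x).
have D : (\int[mu]_x (g n x)%:E)%E @[n --> \oo] --> (\int[mu]_x (f x)%:E)%E.
  apply: (@dominated_cvg _ _ _ mu setT measurableT (fun n x => (g n x)%:E) _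
     (fun x => `|f x|%:E)) => //.
  - move=> n; apply/measurable_EFinP; apply/(measurable_restrictT f (measurable_itv _)).
    by apply: measurable_funTS; exact: continuous_measurable_fun.
  - move=> x _; apply: cvg_near_cst; near=> n.
    rewrite /g patchE mem_set //= in_itv /= -ler_norml.
    apply: (@le_trans _ _ n%:R); last by rewrite ler_nat.
    by near: n; exact: nbhs_infty_ger.
  - have := integrable_abse intf; by apply: eq_integrable.
  - move=> n x _; rewrite /g patchE; case: ifP => _ //=.
    by rewrite normr0 lee_fin.
have Z : (\int[mu]_x (g n x)%:E)%E @[n --> \oo] --> (0 : R)%:E.
  under eq_fun do rewrite I -EFinB.
  apply: cvg_EFin; first exact: nearW.
  apply/cvgrPdist_le => e e0; near=> n.
  rewrite /= sub0r normrN.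
  have n1 : 2 * M / e <= n.+1%:R.
    apply: (@le_trans _ _ n%:R); last by rewrite ler_nat.
    by near: n; exact: nbhs_infty_ger.
  have nn : 0 < (n.+1%:R : R) by rewrite ltr0n.
  have H1 := FM n.+1%:R; have H2 := FM (- n.+1%:R).
  rewrite normrN in H2; rewrite (gtr0_norm nn) in H1 H2.
  rewrite ler_pdivrMr // in n1.
  rewrite -(ler_pM2l nn); apply: (@le_trans _ _ (2 * M)) => //.
  have := ler_normB (F n.+1%:R) (F (- n.+1%:R)).
  move: H1 H2 (normr_ge0 (F n.+1%:R)) (normr_ge0 (F (- n.+1%:R))).
  move: `|F n.+1%:R| `|F (- n.+1%:R)| => p q; nra.
by rewrite /Rintegral (cvg_unique _ D Z).
Unshelve. all: by end_near. Qed.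

End RealLine.

(** * Cosine transforms of the bumps *)

Section Oscillatory.
Variable R : realType.
Variables a b : R.
Hypothesis ab : 0 < a < `|b|.
Let mu := @lebesgue_measure R.
Implicit Types (p : {poly R}) (k j : nat) (c t x : R).

Definition osc_integrand p k j c t x (u : R) : R :=
  smooth_bump a b p k j u * cos ((a * u + c) * x + t).

(** The phase [t] lets a quarter turn stand for differentiation of the cosine, so that sines need no
    second family. The centre [c] is independent of [b]: [psi] has [c = 0], whereas vanishing
    integrals need [c = b]. *)
Definition osc p k j c t x : R := \int[mu]_(u in `[-1, 1]) osc_integrand p k j c t x u.

Lemma continuous_phase c t x : continuous (fun u : R => cos ((a * u + c) * x + t)).
Proof.
move=> u; have D : is_derive u 1 (fun u : R => (a * u + c) * x + t) (a * x).
  have -> : (fun u : R => (a * u + c) * x + t) = (fun u : R => a * x * u + (c * x + t)).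
    by apply/funext => s; ring.
  exact: is_derive_affine.
exact: (is_derive_continuous (is_derive_comp1 (is_derive_cos _) D)).
Qed.

Lemma continuous_osc_integrand p k j c t x :
  continuous (osc_integrand p k j c t x).
Proof.
move=> u; apply: cvgM; first exact: bump_continuous.
exact: continuous_phase.
Qed.

Lemma osc_bounded p k j c t : exists M, forall x, `|osc p k j c t x| <= M.
Proof.
exists (\int[mu]_(u in `[-1, 1]) `|smooth_bump a b p k j u|) => x.
have I := @integrable_itv _ _ (-1) 1 (@continuous_osc_integrand p k j c t x).
apply: (le_trans (le_normr_Rintegral _ I)) => //.
apply: le_Rintegral => //.
- exact: integrable_norm I.
- apply: integrable_norm; apply: integrable_itv; exact: bump_continuous.
- by move=> u _; rewrite /osc_integrand normrM ler_piMr // ler_norml cos_geN1 cos_le1.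
Qed.

Lemma osc_derive p k j c t x :
  is_derive x 1 (osc p k j c t) (osc ((a *: 'X + c%:P) * p) k j c (t + pi / 2) x).
Proof.
have /andP[a0 _] := ab.
pose f y u := osc_integrand p k j c t y u.
have df (y u : R) : is_derive y 1 (f ^~ u)
    (osc_integrand ((a *: 'X + c%:P) * p) k j c (t + pi / 2) y u).
  have := is_derive_mul (is_derive_cst (smooth_bump a b p k j u) y 1)
    (is_derive_comp1 (is_derive_cos _) (is_derive_affine (a * u + c) t y)).
  move/is_derive_eq; apply; rewrite /osc_integrand bumpM addrA cosDpihalf.
  by rewrite hornerD hornerZ hornerX hornerC /=; ring.
pose G (u : R) := `|smooth_bump a b ((a *: 'X + c%:P) * p) k j u|.
have Ix : `]x - 1, x + 1[%classic x by rewrite /= in_itv /=; apply/andP; split; lra.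
have I1 y : `]x - 1, x + 1[%classic y -> mu.-integrable `[-1, 1] (EFin \o f y).
  by move=> _; apply: integrable_itv; exact: continuous_osc_integrand.
have I2 y u : `]x - 1, x + 1[%classic y -> `[-1, 1]%classic u -> derivable (f ^~ u) y 1.
  by move=> _ _; have [] := df y u.
have I3 : mu.-integrable `[-1, 1] (EFin \o G).
  apply: integrable_norm; apply: integrable_itv; exact: bump_continuous.
have I4 y u : `]x - 1, x + 1[%classic y -> `[-1, 1]%classic u -> `|partial1of2 f y u| <= G u.
  move=> _ _; rewrite /partial1of2 (is_derive_val (df y u)) /osc_integrand normrM.
  by rewrite ler_piMr // ler_norml cos_geN1 cos_le1.
have G0 u : 0 <= G u by rewrite /G.
have mI : measurable (`[-1, 1]%classic : set (measurableTypeR R)) by exact: measurable_itv.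
apply: DeriveDef.
  exact: (derivable_under_integral mI Ix I1 I2 G0 I3 I4).
have := differentiation_under_integral mI Ix I1 I2 G0 I3 I4; rewrite derive1E => ->.
by apply: eq_Rintegral => u _; rewrite /partial1of2 (is_derive_val (df x u)).
Qed.

Lemma osc_continuous p k j c t : continuous (osc p k j c t).
Proof. by move=> x; apply: (is_derive_continuous (osc_derive p k j c t x)). Qed.

(** The factor [a * x] is the [u]-derivative of the phase. The bump vanishes at both endpoints, so
    integration by parts leaves no boundary term; its minus sign becomes a quarter turn. Decay of
    every order in [x] follows by iteration. *)
Lemma osc_by_parts p k j c t x :
  a * x * osc p k j c t x = osc (dsmooth_bump a b p k j) k.+2 j.+1 c (t + pi / 2) x.
Proof.
pose G (u : R) := sin ((a * u + c) * x + t).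
have dG (u : R) : is_derive u 1 G (cos ((a * u + c) * x + t) * (a * x)).
  apply: is_derive_comp1.
  have -> : (fun u : R => (a * u + c) * x + t) = (fun u : R => a * x * u + (c * x + t)).
    by apply/funext => s; ring.
  exact: is_derive_affine.
have dB u := is_derive_bump ab p k j u.
have LR (F : R -> R) (F' : R -> R) : (forall u : R, is_derive u 1 F (F' u)) ->
    derivable_oo_LRcontinuous F (-1) 1.
  move=> H; split=> [u _||]; first by have [] := H u.
    by apply: cvg_at_right_filter; exact: (is_derive_continuous (H _)).
  by apply: cvg_at_left_filter; exact: (is_derive_continuous (H _)).
have cf : continuous (smooth_bump a b (dsmooth_bump a b p k j) k.+2 j.+1) by exact: bump_continuous.
have cg : continuous (fun u : R => cos ((a * u + c) * x + t) * (a * x)).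
  by move=> u; apply: cvgM; [exact: continuous_phase | exact: cvg_cst].
have := @Rintegration_by_parts R (smooth_bump a b p k j) G _ _ (-1) 1 _
  (continuous_subspaceT cf) (LR _ _ dB) _ (continuous_subspaceT cg) (LR _ _ dG) _.
rewrite !bump_endpoint ?normrN ?normr1 // !mul0r subrr sub0r => H.
have I := @integrable_itv _ _ (-1) 1 (@continuous_osc_integrand p k j c t x).
rewrite /osc -RintegralZl //.
transitivity (\int[mu]_(u in `[-1, 1])
    (smooth_bump a b p k j u * (cos ((a * (u : R) + c) * x + t) * (a * x)))).
  by apply: eq_Rintegral => u _; rewrite /osc_integrand; ring.
rewrite H; last 3 first.
- by rewrite -subr_gt0 opprK addr_gt0.
- by move=> u _; exact: is_derive_val (dB u).
- by move=> u _; exact: is_derive_val (dG u).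
rewrite -[LHS]mulN1r -RintegralZl //.
  by apply: eq_Rintegral => u _; rewrite /osc_integrand addrA cosDpihalf /G; ring.
apply: integrable_itv => u; apply: cvgM; first exact: cf.
exact: (is_derive_continuous (dG u)).
Qed.

Lemma osc_rapid n p k j c t : exists M, forall x,
  (1 + `|x|) ^+ n * `|osc p k j c t x| <= M.
Proof.
have /andP[a0 _] := ab.
elim: n p k j c t => [|n IH] p k j c t.
  by have [M MH] := osc_bounded p k j c t; exists M => x; rewrite expr0 mul1r.
have [M MH] := IH p k j c t.
have [M' MH'] := IH (dsmooth_bump a b p k j) k.+2 j.+1 c (t + pi / 2).
exists (M + M' / a) => x; rewrite exprSr -mulrA mulrDl mul1r mulrDr.
apply: lerD; first exact: MH.
rewrite ler_pdivlMr //; apply: le_trans (MH' x).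
rewrite -osc_by_parts !normrM (gtr0_norm a0) le_eqVlt; apply/orP; left.
by apply/eqP; ring.
Qed.

Lemma osc_integrable p k j c t : mu.-integrable setT (EFin \o osc p k j c t).
Proof.
have [M MH] := osc_rapid 2 p k j c t.
apply: (@integrable_decay _ _ M) => [|x]; first exact: osc_continuous.
apply: le_trans (MH x); rewrite ler_wpM2r //.
have := normr_ge0 x; rewrite -[x ^+ 2]real_normK ?num_real //; nra.
Qed.

(** No frequency [a * u + b] is zero, so dividing by it, that is raising [j], and turning the phase
    back by a quarter gives an antiderivative in [x] that decays. *)
Lemma osc_integral0 p k j t : \int[mu]_x osc p k j b t x = 0.
Proof.
apply: (@Rintegral_derive_eq0 _ _ (osc p k j.+1 b (t - pi / 2))).
- exact: osc_continuous.
- exact: osc_integrable.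
- move=> x; have := osc_derive p k j.+1 b (t - pi / 2) x.
  move/is_derive_eq; apply; apply: eq_Rintegral => u _.
  by rewrite /osc_integrand bumpM subrK [in RHS](bump_freq ab) hornerD hornerZ hornerX hornerC.
- have [M MH] := osc_rapid 1 p k j.+1 b (t - pi / 2).
  by exists M => x; have := MH x; rewrite expr1.
Qed.

End Oscillatory.

(** * Positivity and translation of integrals *)

Section RealLineIntegral.
Variable R : realType.
Let mu := @lebesgue_measure R.
Implicit Types (f : R -> R).

Lemma Rintegral_EFin f (D : set (measurableTypeR R)) : measurable D ->
  mu.-integrable D (EFin \o f) ->
  (\int[mu]_(x in D) (f x)%:E = (\int[mu]_(x in D) f x)%R%:E)%E.
Proof. by move=> mD If; rewrite /Rintegral fineK // integrable_fin_num. Qed.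

Lemma Rintegral_gt0 f (D : set (measurableTypeR R)) (x0 e c : R) : measurable D ->
  0 < e -> 0 < c -> mu.-integrable D (EFin \o f) ->
  (forall x, x0 - e <= x <= x0 + e -> D x /\ c <= f x) ->
  (forall x, D x -> 0 <= f x) -> 0 < \int[mu]_(x in D) f x.
Proof.
move=> mD e0 c0 If H f0.
pose I : set (measurableTypeR R) := `[x0 - e, x0 + e]%classic.
have mI : measurable I by exact: measurable_itv.
have ID : I `<=` D by move=> x; rewrite /I /= in_itv /= => /H [].
have IfI : mu.-integrable I (EFin \o f) by exact: integrableS If.
have L : \int[mu]_(x in I) f x <= \int[mu]_(x in D) f x.
  rewrite -lee_fin -!Rintegral_EFin //.
  apply: ge0_subset_integral => //; by case/integrableP: If.
apply: lt_le_trans L.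
apply: (@lt_le_trans _ _ (\int[mu]_(x in I) c)).
  rewrite Rintegral_cst //= lebesgue_measure_itv /= lte_fin ifT; last by lra.
  by rewrite -EFinB /= mulr_gt0 //; lra.
apply: le_Rintegral => //.
  by apply: integrable_itv => x; exact: cvg_cst.
by move=> x; rewrite /I /= in_itv /= => /H [].
Qed.

Lemma integral_shift_ge0 f (s : R) : continuous f -> (forall x, 0 <= f x) ->
  (\int[mu]_x (f (s + x))%:E = \int[mu]_x (f x)%:E)%E.
Proof.
move=> cf f0.
have D (x : R) : is_derive x 1 (fun x : R => s + x) 1.
  by have := is_derive_add (is_derive_cst s x 1) (is_derive_id x 1); rewrite add0r.
have E : (fun x : R => s + x)^`() = cst 1.
  by apply/funext => x; exact: is_derive_val (D x).
rewrite [RHS](@increasing_ge0_integration_by_substitutionT R (fun x => s + x)) //.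
- by apply: eq_integral => x _; rewrite E /= mulr1.
- by move=> x y xy; rewrite ltrD2l.
- by rewrite E => x; exact: cvg_cst.
- by rewrite E; apply/cvg_ex; exists 1; exact: cvg_cst.
- by rewrite E; apply/cvg_ex; exists 1; exact: cvg_cst.
- apply/cvgrNyPle => A; near=> x.
  have : x <= A - s by near: x; apply: nbhs_ninfty_le; exact: num_real.
  lra.
- apply/cvgryPge => A; near=> x.
  have : A - s <= x by near: x; apply: nbhs_pinfty_ge; exact: num_real.
  lra.
Unshelve. all: by end_near. Qed.

Lemma continuous_shiftl f (s : R) : continuous f -> continuous (fun x => f (s + x)).
Proof.
move=> cf x; apply: (@continuous_comp _ _ _ (fun x : R => s + x) f); last exact: cf.
by apply: cvgD; [exact: cvg_cst | exact: cvg_id].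
Qed.

Lemma integrable_shift f (s : R) : continuous f -> mu.-integrable setT (EFin \o f) ->
  mu.-integrable setT (EFin \o (fun x => f (s + x))).
Proof.
move=> cf /integrableP[mf If]; apply/integrableP; split.
  by apply/measurable_EFinP; apply: continuous_measurable_fun; exact: continuous_shiftl.
have := @integral_shift_ge0 (fun x => `|f x|) s; rewrite /comp /= => -> //.
by move=> x; apply: cvg_norm; exact: cf.
Qed.

Lemma Rintegral_shift f (s : R) : continuous f -> mu.-integrable setT (EFin \o f) ->
  \int[mu]_x f (s + x) = \int[mu]_x f x.
Proof.
move=> cf If.
have cn : continuous (fun x => `|f x|) by move=> x; apply: cvg_norm; exact: cf.
have In : mu.-integrable setT (EFin \o (fun x => `|f x|)).
  by have := integrable_norm If; apply: eq_integrable.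
have cp : continuous (fun x => `|f x| + f x) by move=> x; apply: cvgD; [exact: cn|exact: cf].
have Ip : mu.-integrable setT (EFin \o (fun x => `|f x| + f x)).
  by have := integrableD measurableT In If; apply: eq_integrable.
have Sn := integrable_shift s cn In.
have Sp := integrable_shift s cp Ip.
have E (g : R -> R) : continuous g -> (forall x, 0 <= g x) -> mu.-integrable setT (EFin \o g) ->
    \int[mu]_x g (s + x) = \int[mu]_x g x.
  move=> cg g0 Ig; apply/EFin_inj; rewrite -!Rintegral_EFin //.
    exact: integral_shift_ge0.
  exact: integrable_shift.
(* Translation is known for nonnegative continuous functions; [f] is a difference of two integrable
   ones. *)
transitivity (\int[mu]_x ((`|f (s + x)| + f (s + x)) - `|f (s + x)|)).
  by apply: eq_Rintegral => x _; rewrite addrAC subrr add0r.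
rewrite (RintegralB measurableT Sp Sn) (E _ cp) //; last first.
  by move=> x; rewrite -lerBlDr sub0r ler_normr lexx orbT.
rewrite (E _ cn) // -(RintegralB measurableT Ip In).
by apply: eq_Rintegral => x _; rewrite addrAC subrr add0r.
Qed.

End RealLineIntegral.

(** * The band-limited function and its square *)

Section BandLimited.
Variable R : realType.
Variable a : R.
Hypothesis a0 : 0 < a.
Let mu := @lebesgue_measure R.

Definition base_bump (u : R) : R :=
  if `|u| < 1 then (1 - u ^+ 2)^-1 * expR (- (1 - u ^+ 2)^-1) else 0.

(** The numerator cancels the frequency factor, so one and the same bump belongs to the family of
    every admissible [b], and [b] can be fitted to the modulating frequency. *)
Lemma base_bumpE b : a < `|b| -> smooth_bump a b (a *: 'X + b%:P) 0 0 = base_bump.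
Proof.
move=> ab; apply/funext => u; rewrite /smooth_bump /base_bump; case: ifP => // u1.
rewrite hornerD hornerZ hornerX hornerC !expr1.
have ab' : 0 < a < `|b| by rewrite a0.
have := freq_neq0 ab' (ltW u1) => z0.
by rewrite [X in X * _]mulrAC mulfV // mul1r.
Qed.

Definition psi (x : R) : R := \int[mu]_(u in `[-1, 1]) (base_bump u * cos (a * u * x)).

Let ab2 : a < `|2 * a|.
Proof. by rewrite gtr0_norm ?mulr_gt0 //; have := a0; lra. Qed.

Lemma psi_osc b : a < `|b| -> psi = osc a b (a *: 'X + b%:P) 0 0 0 0.
Proof.
move=> ab; apply/funext => x; apply: eq_Rintegral => u _.
by rewrite /osc_integrand base_bumpE // !addr0.
Qed.

Lemma base_bump_continuous : continuous base_bump.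
Proof.
have ab2' : 0 < a < `|2 * a| by rewrite a0 ab2.
by rewrite -(base_bumpE ab2); exact: (bump_continuous ab2').
Qed.

Lemma psi_continuous : continuous psi.
Proof.
have ab2' : 0 < a < `|2 * a| by rewrite a0 ab2.
by rewrite (psi_osc ab2); exact: osc_continuous.
Qed.

Lemma psi_rapid n : exists M, forall x, (1 + `|x|) ^+ n * `|psi x| <= M.
Proof.
have ab2' : 0 < a < `|2 * a| by rewrite a0 ab2.
by rewrite (psi_osc ab2); exact: osc_rapid.
Qed.

Lemma psi_integrable : mu.-integrable setT (EFin \o psi).
Proof.
have ab2' : 0 < a < `|2 * a| by rewrite a0 ab2.
by rewrite (psi_osc ab2); exact: osc_integrable.
Qed.

Lemma continuous_cos_affine (y t : R) : continuous (fun x : R => cos (y * x + t)).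
Proof.
move=> x; exact: (is_derive_continuous (is_derive_comp1 (is_derive_cos _)
  (is_derive_affine y t x))).
Qed.

Lemma integrable_mul_bounded (f g : R -> R) : mu.-integrable setT (EFin \o f) ->
  continuous g -> (exists M, forall x, `|g x| <= M) ->
  mu.-integrable setT (EFin \o (fun x => f x * g x)).
Proof.
move=> If cg [M gM].
have := @integrableMl _ _ _ mu setT measurableT (EFin \o f) g If.
apply.
- exact: continuous_measurable_fun.
- exists M; split; first exact: num_real.
  by move=> r Mr x _ /=; apply: le_trans (gM x) (ltW Mr).
Qed.

Lemma cos_bounded (x : R) : `|cos x| <= 1.
Proof. by rewrite ler_norml cos_geN1 cos_le1. Qed.

Lemma psi_cos_integrable y t : mu.-integrable setT (EFin \o (fun x => psi x * cos (y * x + t))).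
Proof.
apply: integrable_mul_bounded; [exact: psi_integrable | exact: continuous_cos_affine |].
by exists 1 => x; exact: cos_bounded.
Qed.

(** By the product formula for cosines, modulation recentres the band of [psi] at [y] and [-y];
    [osc_integral0] then applies with [b = y] and [b = -y]. *)
Lemma psi_cos_integral0 y t : a < `|y| -> \int[mu]_x (psi x * cos (y * x + t)) = 0.
Proof.
move=> ay.
have ay' : a < `|- y| by rewrite normrN.
have ab : 0 < a < `|y| by rewrite a0.
have ab' : 0 < a < `|- y| by rewrite a0.
pose p z := osc a z (a *: 'X + z%:P) 0 0 z.
have E x : psi x * cos (y * x + t) = 2^-1 * (p y t x + p (- y) (- t) x).
  rewrite /p /osc -RintegralD //; last 2 first.
    by apply: integrable_itv; exact: continuous_osc_integrand.
    by apply: integrable_itv; exact: continuous_osc_integrand.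
  rewrite -RintegralZl //; last first.
    apply: integrable_itv => u.
    by apply: cvgD; exact: continuous_osc_integrand.
  rewrite mulrC -RintegralZl //; last first.
    apply: integrable_itv => u; apply: cvgM; first exact: base_bump_continuous.
    have := @continuous_cos_affine (a * x) 0 u.
    by under [fun x0 : R => cos (a * x * x0 + 0)]eq_fun do rewrite addr0 mulrAC.
  apply: eq_Rintegral => u _; rewrite /osc_integrand !base_bumpE //.
  have -> : (a * u + y) * x + t = a * u * x + (y * x + t) by ring.
  have -> : (a * u + - y) * x - t = a * u * x - (y * x + t) by ring.
  by move: (y * x + t) => w; rewrite cosB cosD; field.
transitivity (\int[mu]_x (2^-1 * (p y t x + p (- y) (- t) x))).
  by apply: eq_Rintegral => x _; exact: E.
have I1 := osc_integrable ab (a *: 'X + y%:P) 0 0 y t.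
have I2 := osc_integrable ab' (a *: 'X + (- y)%:P) 0 0 (- y) (- t).
rewrite RintegralZl //; last first.
  by have := integrableD measurableT I1 I2; apply: eq_integrable.
rewrite RintegralD // /p (osc_integral0 ab) (osc_integral0 ab').
by rewrite addr0 mulr0.
Qed.

Lemma base_bump_ge0 u : 0 <= base_bump u.
Proof.
rewrite /base_bump; case: ifP => // u1.
by rewrite mulr_ge0 ?expR_ge0 // invr_ge0 ltW // one_sub_sqr_gt0.
Qed.

Lemma psi0_gt0 : 0 < psi 0.
Proof.
(* For [|u| <= 1 / 2] one has [3 / 4 <= 1 - u ^ 2 <= 1], so the bump is at least [exp (- 4 / 3)]
   there. *)
apply: (@Rintegral_gt0 R _ _ 0 (2^-1) (expR (- (3^-1 * 4)))) => //.
- have := integrable_itv (-1) 1 base_bump_continuous.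
  by apply: eq_integrable => // u _ /=; rewrite mulr0 cos0 mulr1.
- move=> x; rewrite sub0r add0r => x2; split.
    by rewrite /= in_itv /=; apply/andP; split; lra.
  rewrite mulr0 cos0 mulr1 /base_bump.
  have x1 : `|x| < 1 by rewrite ltr_norml; apply/andP; split; lra.
  rewrite x1; have s0 := one_sub_sqr_gt0 x1.
  have s1 : 3 / 4 <= 1 - x ^+ 2 by nra.
  have s2 : 1 - x ^+ 2 <= 1 by have := sqr_ge0 x; lra.
  have v1 : 1 <= (1 - x ^+ 2)^-1 by rewrite invf_ge1.
  have v2 : (1 - x ^+ 2)^-1 <= 3^-1 * 4.
    rewrite -[3^-1 * 4]invrK lef_pV2 ?posrE // ?invr_gt0 ?mulr_gt0 //; lra.
  apply: (@le_trans _ _ (1 * expR (- (1 - x ^+ 2)^-1))).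
    by rewrite mul1r ler_expR lerN2.
  by rewrite ler_wpM2r // expR_ge0.
- by move=> x _; rewrite mulr0 cos0 mulr1 base_bump_ge0.
Qed.

Lemma psi_bounded : exists M, forall x, `|psi x| <= M.
Proof. by have [M H] := psi_rapid 0; exists M => x; rewrite -[leLHS]mul1r -(expr0 (1 + `|x|)). Qed.

Lemma psi_sqr_cos_integrable y t :
  mu.-integrable setT (EFin \o (fun x => psi x ^+ 2 * cos (y * x + t))).
Proof.
have := @integrable_mul_bounded psi (fun x => psi x * cos (y * x + t)) psi_integrable.
have E : (fun x => psi x * (psi x * cos (y * x + t))) = (fun x => psi x ^+ 2 * cos (y * x + t)).
  by apply/funext => x; rewrite mulrA expr2.
rewrite E; apply.
  move=> x; apply: cvgM; [exact: psi_continuous | exact: continuous_cos_affine].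
have [M HM] := psi_bounded; exists M => x.
rewrite normrM; apply: le_trans (HM x); rewrite ler_piMr //; exact: cos_bounded.
Qed.

Lemma psi_sqr_cos_continuous y t : continuous (fun x => psi x ^+ 2 * cos (y * x + t)).
Proof.
move=> x; apply: cvgM; last exact: continuous_cos_affine.
by apply: cvgM; exact: psi_continuous.
Qed.

Definition psi_norm2 := \int[mu]_x (psi x ^+ 2).

Lemma psi_sqr_integrable : mu.-integrable setT (EFin \o (fun x => psi x ^+ 2)).
Proof.
have := psi_sqr_cos_integrable 0 0; apply: eq_integrable => // x _ /=.
by rewrite mul0r addr0 cos0 mulr1.
Qed.

Lemma psi_norm2_gt0 : 0 < psi_norm2.
Proof.
have p0 := psi0_gt0.
have : \forall x \near (0 : R), psi 0 / 2 < psi x.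
  by have := cvgr_gt _ (psi_continuous (x := 0)); apply; lra.
move=> /nbhs_ballP[e /= e0 eH].
apply: (@Rintegral_gt0 R _ _ 0 (e / 2) ((psi 0 / 2) ^+ 2)) => //.
- by rewrite divr_gt0.
- by rewrite exprn_gt0 // divr_gt0.
- exact: psi_sqr_integrable.
- move=> x; rewrite sub0r add0r => /andP[x1 x2]; split => //.
  have : psi 0 / 2 < psi x.
    apply: eH; rewrite /ball /= sub0r normrN ltr_norml; apply/andP; split; lra.
  move=> /ltW H; rewrite lerXn2r // ?nnegrE; lra.
- by move=> x _; exact: sqr_ge0.
Qed.

Lemma base_bump_out u : ~ (`[-1, 1]%classic : set R) u -> base_bump u = 0.
Proof.
move=> H; rewrite /base_bump; case: ifP => // u1; exfalso; apply: H.
by rewrite /= in_itv /= -ler_norml ltW.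
Qed.

Lemma base_bump_integrable : mu.-integrable setT (EFin \o base_bump).
Proof.
have -> : EFin \o base_bump = (EFin \o base_bump) \_ `[-1, 1].
  apply/funext => u; rewrite patchE; case: ifPn => // /negP H /=.
  by rewrite base_bump_out // => K; apply: H; rewrite inE.
have mI : measurable (`[-1, 1]%classic : set (measurableTypeR R)) by exact: measurable_itv.
apply/(integrable_mkcond _ mI).
by apply: integrable_itv; exact: base_bump_continuous.
Qed.

Lemma psi_line x : psi x = \int[mu]_u (base_bump u * cos (a * u * x)).
Proof.
rewrite /psi Rintegral_mkcond; apply: eq_Rintegral => u _.
rewrite patchE; case: ifPn => // /negP H.
by rewrite base_bump_out ?mul0r // => K; apply: H; rewrite inE.
Qed.

(** One factor [psi] is expanded as an integral over [u] and the order exchanged. The inner integral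
    then involves the frequencies [y + a * u] and [y - a * u], which for [|u| < 1] remain outside
    the band of the other factor. *)
Lemma psi_sqr_cos_integral0 y t : 2 * a < `|y| ->
  \int[mu]_x (psi x ^+ 2 * cos (y * x + t)) = 0.
Proof.
move=> ay.
pose g (x u : R) := psi x * cos (y * x + t) * (base_bump u * cos (a * u * x)).
pose f (z : measurableTypeR R * measurableTypeR R) : \bar R := (g z.1 z.2)%:E.
have mcos : measurable_fun setT (@cos R) by apply: continuous_measurable_fun; exact: continuous_cos.
have mf : measurable_fun setT f.
  apply/measurable_EFinP; apply: measurable_funM.
    apply: (measurableT_comp (f := fun x => psi x * cos (y * x + t))) => //.
    apply: continuous_measurable_fun => x; apply: cvgM; first exact: psi_continuous.
    exact: continuous_cos_affine.
  apply: measurable_funM.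
    apply: (measurableT_comp (f := base_bump)) => //.
    by apply: continuous_measurable_fun; exact: base_bump_continuous.
  apply: (measurableT_comp mcos); apply: measurable_funM => //.
  by apply: measurable_funM.
have ccos (c e : R) : continuous (fun u : R => cos (c * u + e)) by exact: continuous_cos_affine.
have Iu x : mu.-integrable setT (EFin \o (fun u => base_bump u * cos (a * u * x))).
  apply: integrable_mul_bounded; first exact: base_bump_integrable.
    move=> u; have := ccos (a * x) 0 u.
    by under [fun x0 : R => cos (a * x * x0 + 0)]eq_fun do rewrite addr0 mulrAC.
  by exists 1 => u; exact: cos_bounded.
have Igu x : mu.-integrable setT (EFin \o g x).
  by have := integrableZl measurableT (psi x * cos (y * x + t)) (Iu x); apply: eq_integrable.
have imf : (mu \x mu)%E.-integrable setT f.
  apply: (proj2 (@integrable12ltyP _ _ _ _ _ mu mu f mf)).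
  apply: (@le_lt_trans _ _ (\int[mu]_x (`|psi x| * \int[mu]_u base_bump u)%R%:E)%E).
    apply: ge0_le_integral => //.
    - by move=> x _; exact: integral_ge0.
    - apply: (measurable_fun_fubini_tonelli_F (abse \o f)) => //=.
      exact: measurableT_comp.
    - apply/measurable_EFinP; apply: measurable_funM => //.
      apply: measurableT_comp => //; apply: continuous_measurable_fun; exact: psi_continuous.
    - move=> x _; rewrite EFinM -(Rintegral_EFin measurableT base_bump_integrable).
      have mb : measurable_fun setT (EFin \o base_bump) by case/integrableP: base_bump_integrable.
      have b0 u : (0 <= (base_bump u)%:E)%E by rewrite lee_fin base_bump_ge0.
      rewrite -ge0_integralZl //.
      apply: ge0_le_integral => //.
      + by apply: measurableT_comp => //; case/integrableP: (Igu x).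
      + exact: measurable_funeM.
      + move=> u _; rewrite /f /= lee_fin /g !normrM [`|base_bump u|]ger0_norm ?base_bump_ge0 //.
        apply: ler_pM; rewrite ?mulr_ge0 ?base_bump_ge0 //.
          by rewrite ler_piMr // cos_bounded.
        by rewrite ler_piMr ?base_bump_ge0 // cos_bounded.
  have IP := integrableZr measurableT (\int[mu]_u base_bump u) (integrable_norm psi_integrable).
  have := integrable_fin_num measurableT IP; rewrite fin_numElt => /andP[_].
  by apply: le_lt_trans; apply: le_integral.
have L x : (\int[mu]_u f (x, u) = (psi x ^+ 2 * cos (y * x + t))%:E)%E.
  rewrite /f /= (Rintegral_EFin measurableT (Igu x)); congr (_%:E).
  by rewrite /g RintegralZl // -psi_line mulrAC expr2.
have Rz u : (\int[mu]_x f (x, u) = 0)%E.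
  rewrite /f /=; case: (ltrP `|u| 1) => u1; last first.
    apply: integral0_eq => x _.
    by rewrite /g /base_bump ltNge u1 /= mul0r mulr0.
  have au : `|a * u| <= a by rewrite normrM gtr0_norm // ger_pMr // ltW.
  have a1 : a < `|y + a * u|.
    by have := ler_normB (y + a * u) (a * u); rewrite addrK; lra.
  have a2 : a < `|y - a * u|.
    by have := ler_normD (y - a * u) (a * u); rewrite subrK; lra.
  pose h x := (base_bump u / 2) * (psi x * cos ((y + a * u) * x + t) + psi x * cos ((y - a * u) * x + t)).
  have I1 := psi_cos_integrable (y + a * u) t.
  have I2 := psi_cos_integrable (y - a * u) t.
  have I12 : mu.-integrable setT (EFin \o (fun x => psi x * cos ((y + a * u) * x + t) +
      psi x * cos ((y - a * u) * x + t))).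
    by have := integrableD measurableT I1 I2; apply: eq_integrable.
  have Ih : mu.-integrable setT (EFin \o h).
    by have := integrableZl measurableT (base_bump u / 2) I12; apply: eq_integrable.
  have E x : g x u = h x.
    rewrite /g /h.
    have -> : (y + a * u) * x + t = (y * x + t) + a * u * x by ring.
    have -> : (y - a * u) * x + t = (y * x + t) - a * u * x by ring.
    by move: (y * x + t) => w; rewrite cosB cosD; field.
  under eq_integral do rewrite E.
  rewrite (Rintegral_EFin measurableT Ih) /h RintegralZl // RintegralD //.
  by rewrite !psi_cos_integral0 // addr0 mulr0.
apply: EFin_inj; rewrite -(Rintegral_EFin measurableT (psi_sqr_cos_integrable y t)).
under eq_integral do rewrite -L.
rewrite (Fubini imf).
under eq_integral do rewrite Rz.
by rewrite integral0.
Qed.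

Lemma psi_shift_integrable s y t :
  mu.-integrable setT (EFin \o (fun x => psi (s + x) ^+ 2 * cos (y * x + t))).
Proof.
have := integrable_shift s (@psi_sqr_cos_continuous y (t - y * s)) (psi_sqr_cos_integrable _ _).
apply: eq_integrable => // x _ /=; congr (_ * cos _)%:E; ring.
Qed.

Lemma psi_shift_integral s y t : \int[mu]_x (psi (s + x) ^+ 2 * cos (y * x + t)) =
  \int[mu]_x (psi x ^+ 2 * cos (y * x + (t - y * s))).
Proof.
rewrite -(Rintegral_shift s (@psi_sqr_cos_continuous y (t - y * s))) //.
  by apply: eq_Rintegral => x _; congr (_ * cos _); ring.
exact: psi_sqr_cos_integrable.
Qed.

Lemma psi_shift_integral0 s y t : 2 * a < `|y| ->
  \int[mu]_x (psi (s + x) ^+ 2 * cos (y * x + t)) = 0.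
Proof. by move=> ay; rewrite psi_shift_integral psi_sqr_cos_integral0. Qed.

Lemma psi_shift_integral1 s t :
  \int[mu]_x (psi (s + x) ^+ 2 * cos (0 * x + t)) = cos t * psi_norm2.
Proof.
rewrite psi_shift_integral /psi_norm2 -RintegralZl //; last exact: psi_sqr_integrable.
by apply: eq_Rintegral => x _; rewrite !mul0r subr0 add0r mulrC.
Qed.

End BandLimited.

(** * Directional derivatives *)

Section DirectionalDerivative.
Variables (R : realType) (W : normedModType R).
Implicit Types (f g : W -> R) (x v : W) (a b : R).

Lemma is_derive_line f x v a :
  is_derive (0 : R) 1 (fun h : R => f (h *: v + x)) a -> is_derive x v f a.
Proof.
move=> [D1 D2].
have E : (fun h : R => h^-1 *: (((fun h : R => f (h *: v + x)) \o shift 0) (h *: (1 : R)) -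
    f ((0 : R) *: v + x))) = (fun h : R => h^-1 *: ((f \o shift x) (h *: v) - f x)).
  by apply/funext => h /=; rewrite addr0 scale0r add0r /GRing.scale /= mulr1.
apply: DeriveDef; first by rewrite /derivable -E.
by rewrite /derive -E.
Qed.

Lemma is_dderive_mul f g x v a b : is_derive x v f a -> is_derive x v g b ->
  is_derive x v (fun t => f t * g t) (a * g x + f x * b).
Proof.
move=> Hf Hg; have := is_deriveM Hf Hg.
by rewrite addrC /GRing.scale /= [g x * a]mulrC.
Qed.

Lemma is_dderive_add f g x v a b : is_derive x v f a -> is_derive x v g b ->
  is_derive x v (fun t => f t + g t) (a + b).
Proof. by move=> Hf Hg; have := is_deriveD Hf Hg. Qed.

End DirectionalDerivative.

(** * Tensor products in the Schwartz class *)

Section SchwartzTensor.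
Variables (R : realType) (d : nat) (a : R).
Hypothesis a0 : 0 < a.
Local Notation V := 'rV[R]_d.
Local Notation C := R[i].
Implicit Types (f g : V -> R).

Let ab2 : 0 < a < `|2 * a|.
Proof. by rewrite a0 gtr0_norm ?mulr_gt0 //; have := a0; lra. Qed.

(** Here [2 * a] is just one admissible choice of [b]; differentiability and decay need only
    [a < |b|]. *)
Definition oscillatory (g : R -> R) : Prop :=
  exists p k j c t, g = osc a (2 * a) p k j c t.

Lemma oscillatory_derive (g : R -> R) : oscillatory g ->
  exists2 g', oscillatory g' & forall x : R, is_derive x 1 g (g' x).
Proof.
move=> [p [k [j [c [t ->]]]]].
exists (osc a (2 * a) ((a *: 'X + c%:P) * p) k j c (t + pi / 2)).
  by exists ((a *: 'X + c%:P) * p), k, j, c, (t + pi / 2).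
by move=> x; exact: osc_derive.
Qed.

Lemma oscillatory_rapid (g : R -> R) n : oscillatory g ->
  exists M, forall x : R, (1 + `|x|) ^+ n * `|g x| <= M.
Proof. by move=> [p [k [j [c [t ->]]]]]; exact: osc_rapid. Qed.

Lemma oscillatory_psi : oscillatory (psi a).
Proof.
have /andP[_ H] := ab2; rewrite (psi_osc a0 H).
by exists (a *: 'X + (2 * a)%:P), 0%N, 0%N, 0, 0.
Qed.

Inductive tame : (V -> R) -> Prop :=
| tame_cst c : tame (fun=> c)
| tame_osc (g : R -> R) (s : R) (i : 'I_d) : oscillatory g -> tame (fun t => g (s + t 0 i))
| tame_cos l c : tame (fun t => cos (dotp t l + c))
| tame_mul f g : tame f -> tame g -> tame (fun t => f t * g t)
| tame_add f g : tame f -> tame g -> tame (fun t => f t + g t).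

(** A factor in one coordinate is bounded but does not decay in the other directions; only a product
    over all coordinates does. So decay is carried by a module over the algebra [tame], and both are
    closed under partial derivatives. *)
Inductive rapid : (V -> R) -> Prop :=
| rapid_osc (G : 'I_d -> R -> R) (s : V) : (forall i, oscillatory (G i)) ->
    rapid (fun t => \prod_i G i (s 0 i + t 0 i))
| rapid_mul f g : rapid f -> tame g -> rapid (fun t => f t * g t)
| rapid_add f g : rapid f -> rapid g -> rapid (fun t => f t + g t).

Lemma line_coord (h : R) (i j : 'I_d) (x : V) :
  (h *: ebasis R i + x) 0 j = (if j == i then h else 0) + x 0 j.
Proof. by rewrite !mxE /= eq_sym; case: eqP => _; rewrite ?mulr1 ?mulr0. Qed.

Lemma tame_bounded f : tame f -> exists M, forall x, `|f x| <= M.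
Proof.
elim=> [c|g s i Hg|l c|f1 f2 _ [M1 H1] _ [M2 H2]|f1 f2 _ [M1 H1] _ [M2 H2]].
- by exists `|c|.
- have [M HM] := oscillatory_rapid 0 Hg; exists M => x.
  by have := HM (s + x 0 i); rewrite expr0 mul1r.
- by exists 1 => x; exact: cos_bounded.
- by exists (M1 * M2) => x; rewrite normrM ler_pM.
- by exists (M1 + M2) => x; rewrite (le_trans (ler_normD _ _)) // lerD.
Qed.

Lemma tame_derive f : tame f -> forall i,
  exists2 f', tame f' & forall x, is_derive x (ebasis R i) f (f' x).
Proof.
elim=> [c|g s j Hg|l c|f1 f2 T1 H1 T2 H2|f1 f2 _ H1 _ H2] i.
- by exists (fun=> 0); [exact: tame_cst | move=> x; exact: is_derive_cst].
- have [g' Hg' Dg] := oscillatory_derive Hg.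
  case: (eqVneq j i) => [->|ji].
    exists (fun t => g' (s + t 0 i)); first exact: tame_osc.
    move=> x; apply: is_derive_line.
    have -> : (fun h : R => g (s + (h *: ebasis R i + x) 0 i)) =
       (fun h : R => g (1 * h + (s + x 0 i))).
      by apply/funext => h; rewrite line_coord eqxx mul1r addrCA.
    have := is_derive_comp1 (g := fun h : R => 1 * h + (s + x 0 i)) (Dg _)
      (is_derive_affine 1 (s + x 0 i) 0).
    by rewrite mulr1 mulr0 add0r.
  exists (fun=> 0); first exact: tame_cst.
  move=> x; apply: is_derive_line.
  have -> : (fun h : R => g (s + (h *: ebasis R i + x) 0 j)) = cst (g (s + x 0 j)).
    by apply/funext => h; rewrite line_coord (negbTE ji) add0r.
  exact: is_derive_cst.
- exists (fun t => l 0 i * cos (dotp t l + (c + pi / 2))).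
    by apply: tame_mul; [exact: tame_cst | exact: tame_cos].
  move=> x; apply: is_derive_line.
  have -> : (fun h : R => cos (dotp (h *: ebasis R i + x) l + c)) =
     (fun h : R => cos (l 0 i * h + (dotp x l + c))).
    apply/funext => h; rewrite dotpDl dotpZl; congr cos.
    have -> : dotp (ebasis R i) l = l 0 i.
      rewrite /dotp (bigD1 i) //= big1 ?addr0 => [|j ji]; first by rewrite mxE !eqxx mul1r.
      by rewrite mxE (negbTE ji) andbF mul0r.
    ring.
  have := is_derive_comp1 (g := fun h : R => l 0 i * h + (dotp x l + c)) (is_derive_cos _)
    (is_derive_affine (l 0 i) (dotp x l + c) 0).
  by move/is_derive_eq; apply; rewrite mulr0 add0r [in RHS]addrA cosDpihalf mulrC.
- have [f1' T1' D1] := H1 i; have [f2' T2' D2] := H2 i.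
  exists (fun t => f1' t * f2 t + f1 t * f2' t).
    by apply: tame_add; apply: tame_mul.
  by move=> x; exact: is_dderive_mul.
- have [f1' T1' D1] := H1 i; have [f2' T2' D2] := H2 i.
  by exists (fun t => f1' t + f2' t); [exact: tame_add | move=> x; exact: is_dderive_add].
Qed.

Lemma rapid_derive f : rapid f -> forall i,
  exists2 f', rapid f' & forall x, is_derive x (ebasis R i) f (f' x).
Proof.
elim=> [G s HG|f1 f2 T1 H1 T2|f1 f2 _ H1 _ H2] i.
- have [g' Hg' Dg] := oscillatory_derive (HG i).
  exists (fun t => \prod_j (if j == i then g' else G j) (s 0 j + t 0 j)).
    by apply: (@rapid_osc (fun j => if j == i then g' else G j) s) => j; case: eqP.
  move=> x; apply: is_derive_line.
  have -> : (fun h : R => \prod_j G j (s 0 j + (h *: ebasis R i + x) 0 j)) =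
     (fun h : R => G i (1 * h + (s 0 i + x 0 i)) * \prod_(j | j != i) G j (s 0 j + x 0 j)).
    apply/funext => h; rewrite (bigD1 i) //=; congr (_ * _).
      by rewrite line_coord eqxx mul1r addrCA.
    by apply: eq_bigr => j /negbTE ji; rewrite line_coord ji add0r.
  have := is_derive_mul (is_derive_comp1 (g := fun h : R => 1 * h + (s 0 i + x 0 i)) (Dg _)
    (is_derive_affine 1 (s 0 i + x 0 i) 0))
    (is_derive_cst (\prod_(j | j != i) G j (s 0 j + x 0 j)) (0 : R) 1).
  move/is_derive_eq; apply; rewrite !mulr0 !addr0 mulr1 !add0r.
  rewrite [RHS](bigD1 i) //= eqxx; congr (_ * _).
  by apply: eq_bigr => j /negbTE ->.
- have [f1' T1' D1] := H1 i; have [f2' T2' D2] := tame_derive T2 i.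
  exists (fun t => f1' t * f2 t + f1 t * f2' t).
    by apply: rapid_add; apply: rapid_mul.
  by move=> x; exact: is_dderive_mul.
- have [f1' T1' D1] := H1 i; have [f2' T2' D2] := H2 i.
  by exists (fun t => f1' t + f2' t); [exact: rapid_add | move=> x; exact: is_dderive_add].
Qed.

Lemma sum_le_prod (I : finType) (u : I -> R) : (forall i, 0 <= u i) ->
  1 + \sum_i u i <= \prod_i (1 + u i).
Proof.
move=> u0; suff : 1 + \sum_i u i <= \prod_i (1 + u i) /\ 0 <= \sum_i u i by case.
elim/big_ind2 : _ => [|x1 x2 y1 y2 [H1 p1] [H2 p2]|i _].
- by rewrite addr0.
- split; last exact: addr_ge0.
  nra.
- by [].
Qed.

Lemma enorm_le_sum (x : V) : enorm x <= \sum_i `|x 0 i|.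
Proof.
have S0 : 0 <= \sum_i `|x 0 i| by apply: sumr_ge0.
rewrite /enorm -(ger0_norm S0) -sqrtr_sqr; apply: ler_wsqrtr.
rewrite /dotp expr2 mulr_suml; apply: ler_sum => i _.
rewrite -expr2 -[_ ^+ 2]real_normK ?num_real // expr2 ler_wpM2l //.
by rewrite (bigD1 i) //= lerDl sumr_ge0.
Qed.

Lemma enorm_ge0 (x : V) : 0 <= enorm x.
Proof. exact: sqrtr_ge0. Qed.

(** The Euclidean weight [1 + enorm x] is at most the product of the [1 + |x i|], and each of these
    is at most [(1 + |s i|) * (1 + |s i + x i|)], so the decay in each coordinate suffices. *)
Lemma rapid_decay f k : rapid f -> exists M, forall x, (1 + enorm x) ^+ k * `|f x| <= M.
Proof.
have e1 (x : V) : 0 <= (1 + enorm x) ^+ k.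
  by apply: exprn_ge0; apply: addr_ge0 => //; exact: enorm_ge0.
elim=> [G s HG|f1 f2 _ [M1 H1] T2|f1 f2 _ [M1 H1] _ [M2 H2]].
- have /choice[M HM] : forall i, exists M, forall x : R, (1 + `|x|) ^+ k * `|G i x| <= M.
    by move=> i; exact: oscillatory_rapid.
  exists (\prod_i ((1 + `|s 0 i|) ^+ k * M i)) => x.
  apply: (@le_trans _ _ (\prod_i ((1 + `|s 0 i|) ^+ k *
     ((1 + `|s 0 i + x 0 i|) ^+ k * `|G i (s 0 i + x 0 i)|)))); last first.
    apply: ler_prod => i _; rewrite !mulr_ge0 ?exprn_ge0 ?addr_ge0 //=.
    by rewrite ler_wpM2l ?exprn_ge0 ?addr_ge0.
  rewrite normr_prod; under [leRHS]eq_bigr do rewrite mulrA -exprMn.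
  rewrite big_split /= ler_wpM2r ?prodr_ge0 // prodrXl.
  rewrite lerXn2r ?nnegrE ?addr_ge0 ?enorm_ge0 //.
    by apply: prodr_ge0 => i _; rewrite mulr_ge0 ?addr_ge0.
  apply: (@le_trans _ _ (\prod_i (1 + `|x 0 i|))).
    by apply: le_trans (sum_le_prod _) => //; rewrite lerD2l enorm_le_sum.
  apply: ler_prod => i _; rewrite addr_ge0 //=.
  have := ler_normB (s 0 i + x 0 i) (s 0 i); rewrite addrAC subrr add0r.
  have := normr_ge0 (s 0 i); have := normr_ge0 (s 0 i + x 0 i).
  move: `|s 0 i| `|_ + _| `|x 0 i| => p q r; nra.
- have [M2 H2] := tame_bounded T2.
  exists (M1 * M2) => x; rewrite normrM mulrA ler_pM // mulr_ge0 //.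
- exists (M1 + M2) => x; apply: (@le_trans _ _ ((1 + enorm x) ^+ k * (`|f1 x| + `|f2 x|))).
    by rewrite ler_wpM2l // ler_normD.
  by rewrite mulrDr lerD.
Qed.

Lemma rapid_pderivs f s : rapid f -> rapid (pderivs s f).
Proof.
move=> Hf; elim: s => [//|i s IH]; have [f' Hf' D] := rapid_derive IH i.
suff -> : pderivs (i :: s) f = f' by [].
by apply/funext => x /=; have [_] := D x.
Qed.

Lemma rapid_schwartz f : rapid f -> schwartzR f.
Proof.
move=> Hf; split=> [s i x|s k]; have Hs := rapid_pderivs s Hf.
  by have [f' _ D] := rapid_derive Hs i; have [] := D x.
exact: rapid_decay.
Qed.

Definition psi_tensor (t : V) : R := \prod_i psi a (t 0 i) ^+ 2.

Definition test_fun (x l t : V) : C :=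
  real_complex R (psi_tensor (x + t)) * cexp2pi (dotp (x + t) l).

Lemma test_fun_schwartz x l : schwartz (test_fun x l).
Proof.
pose P (t : V) := \prod_i psi a (x 0 i + t 0 i).
have rP : rapid P by apply: (@rapid_osc (fun=> psi a) x) => i; exact: oscillatory_psi.
(* The square is [P * P]: one factor supplies the decay, the other enters only as a bounded
   multiplier. *)
have tP : tame P.
  rewrite /P; elim: (index_enum _) => [|i r IH].
    by under eq_fun do rewrite big_nil; exact: tame_cst.
  under eq_fun do rewrite big_cons.
  by apply: tame_mul => //; apply: tame_osc; exact: oscillatory_psi.
have H c : rapid (fun t => P t * P t * cos (dotp t ((2 * pi) *: l) + c)).
  by apply: rapid_mul; [exact: rapid_mul | exact: tame_cos].
have E t : psi_tensor (x + t) = P t * P t.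
  rewrite /psi_tensor /P -big_split; apply: eq_bigr => i _ /=.
  by rewrite mxE expr2.
have D t : dotp t ((2 * pi) *: l) + 2 * pi * dotp x l = 2 * pi * dotp (x + t) l.
  by rewrite dotpDl dotpC dotpZl [dotp l t]dotpC; ring.
split; apply: rapid_schwartz.
  have -> : (fun t => complex.Re (test_fun x l t)) = (fun t => P t * P t *
     cos (dotp t ((2 * pi) *: l) + (2 * pi * dotp x l))).
    by apply/funext => t; rewrite /test_fun /= mul0r subr0 E D.
  exact: H.
have -> : (fun t => complex.Im (test_fun x l t)) = (fun t => P t * P t *
   cos (dotp t ((2 * pi) *: l) + (2 * pi * dotp x l - pi / 2))).
  apply/funext => t; rewrite /test_fun /= mul0r addr0 E addrA D.
  by rewrite -[in LHS](subrK (pi / 2) (2 * pi * dotp (x + t) l)) sinDpihalf.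
exact: H.
Qed.

End SchwartzTensor.

(** * Fourier transform of the test functions *)

Section FourierTensor.
Variable R : realType.
Local Notation C := R[i].
Let mu := @lebesgue_measure R.

Definition cint (F : R -> C) : C :=
  Complex (\int[mu]_x complex.Re (F x)) (\int[mu]_x complex.Im (F x)).

Lemma Re_mulC (z w : C) :
  complex.Re (z * w) = complex.Re z * complex.Re w - complex.Im z * complex.Im w.
Proof. by case: z => ? ?; case: w. Qed.

Lemma Re_Rintegral (z : C) (F : R -> C) :
  mu.-integrable setT (EFin \o (fun x => complex.Re (F x))) ->
  mu.-integrable setT (EFin \o (fun x => complex.Im (F x))) ->
  \int[mu]_x complex.Re (z * F x) = complex.Re (z * cint F).
Proof.
move=> I1 I2; rewrite Re_mulC /= -!RintegralZl // -RintegralB //.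
- by apply: eq_Rintegral => x _; rewrite Re_mulC.
- by have := integrableZl measurableT (complex.Re z) I1; apply: eq_integrable.
- by have := integrableZl measurableT (complex.Im z) I2; apply: eq_integrable.
Qed.

Lemma row_cons0 d (x : R) (y : 'rV[R]_d) : row_mx (const_mx x : 'rV_1) y 0 ord0 = x.
Proof.
have -> : (ord0 : 'I_(1 + d)) = lshift d ord0 by apply: val_inj.
by rewrite row_mxEl mxE.
Qed.

Lemma row_consS d (x : R) (y : 'rV[R]_d) (i : 'I_d) :
  row_mx (const_mx x : 'rV_1) y 0 (lift ord0 i) = y 0 i.
Proof.
have -> : (lift ord0 i : 'I_(1 + d)) = rshift 1 i by apply: val_inj.
by rewrite row_mxEr.
Qed.

(** [integ] takes real functions, and the real part of a product is not a product of real parts. The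
    free factor [z] absorbs the value at the outer coordinate, so the induction stays within complex
    products. *)
Lemma integ_prod_Re d (z : C) (F : 'I_d -> R -> C) :
  (forall i, mu.-integrable setT (EFin \o (fun x => complex.Re (F i x))) /\
             mu.-integrable setT (EFin \o (fun x => complex.Im (F i x)))) ->
  integ (fun t : 'rV[R]_d => complex.Re (z * \prod_i F i (t 0 i))) =
  complex.Re (z * \prod_i cint (F i)).
Proof.
elim: d z F => [|d IH] z F HF /=; first by rewrite !big_ord0.
rewrite big_ord_recl [cint _ * _]mulrC mulrA -Re_Rintegral; try exact: (HF ord0).1; try exact: (HF ord0).2.
apply: eq_Rintegral => x _.
rewrite mulrAC -(IH _ (fun i => F (lift ord0 i))) => [|i]; last exact: HF.
congr integ; apply/funext => y; congr complex.Re.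
rewrite big_ord_recl mulrA row_cons0; congr (_ * _).
by apply: eq_bigr => i _; rewrite row_consS.
Qed.

Lemma Im_as_Re (z : C) : complex.Im z = complex.Re (Complex 0 (-1) * z).
Proof. by rewrite Re_mulC /= mul0r sub0r mulN1r opprK. Qed.

Lemma cinteg_prod d (F : 'I_d -> R -> C) :
  (forall i, mu.-integrable setT (EFin \o (fun x => complex.Re (F i x))) /\
             mu.-integrable setT (EFin \o (fun x => complex.Im (F i x)))) ->
  cinteg (fun t : 'rV[R]_d => \prod_i F i (t 0 i)) = \prod_i cint (F i).
Proof.
move=> HF; rewrite /cinteg; apply/eqP; rewrite eq_complex /=; apply/andP; split; apply/eqP.
  rewrite -[in RHS](mul1r (\prod_i cint (F i))) -integ_prod_Re //.
  by under [in RHS]eq_fun do rewrite mul1r.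
rewrite [RHS]Im_as_Re -integ_prod_Re //.
by congr integ; apply/funext => t; rewrite Im_as_Re.
Qed.

Variables (d : nat) (a : R).
Hypothesis a0 : 0 < a.
Local Notation V := 'rV[R]_d.

Let F (x l y : V) (i : 'I_d) (s : R) : C :=
  real_complex R (psi a (x 0 i + s) ^+ 2) * cexp2pi ((x 0 i + s) * l 0 i - s * y 0 i).

Let FE (x l y : V) (i : 'I_d) (s : R) : F x l y i s =
  Complex (psi a (x 0 i + s) ^+ 2 *
             cos ((2 * pi * (l 0 i - y 0 i)) * s + 2 * pi * (x 0 i * l 0 i)))
          (psi a (x 0 i + s) ^+ 2 *
             cos ((2 * pi * (l 0 i - y 0 i)) * s + (2 * pi * (x 0 i * l 0 i) - pi / 2))).
Proof.
rewrite /F addrA; set w := _ * s + _.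
have -> : cexp2pi ((x 0 i + s) * l 0 i - s * y 0 i) = Complex (cos w) (sin w).
  rewrite /cexp2pi; have -> : 2 * pi * ((x 0 i + s) * l 0 i - s * y 0 i) = w by rewrite /w; ring.
  by [].
rewrite -[in sin w](subrK (pi / 2) w) sinDpihalf.
by apply/eqP; rewrite eq_complex /= !mul0r subr0 addr0 !eqxx.
Qed.

Lemma fourier_test_fun (x l y : V) : fourier (test_fun a x l) y = \prod_i cint (F x l y i).
Proof.
rewrite -cinteg_prod => [|i].
  congr cinteg; apply/funext => t.
  rewrite /test_fun /F big_split /= -cexp2pi_sum -mulrA -cexp2piD; congr (_ * cexp2pi _).
    rewrite -rmorph_prod; congr (real_complex R _).
    by apply: eq_bigr => i _; rewrite mxE.
  by rewrite /dotp sumrB; congr (_ - _); apply: eq_bigr => i _; rewrite mxE.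
split.
  have := psi_shift_integrable a0 (x 0 i) (2 * pi * (l 0 i - y 0 i)) (2 * pi * (x 0 i * l 0 i)).
  by apply: eq_integrable => // s _; rewrite /comp FE.
have := psi_shift_integrable a0 (x 0 i) (2 * pi * (l 0 i - y 0 i))
  (2 * pi * (x 0 i * l 0 i) - pi / 2).
by apply: eq_integrable => // s _; rewrite /comp FE.
Qed.

Lemma cintE (x l y : V) i : cint (F x l y i) = Complex
  (\int[mu]_s (psi a (x 0 i + s) ^+ 2 *
     cos ((2 * pi * (l 0 i - y 0 i)) * s + 2 * pi * (x 0 i * l 0 i))))
  (\int[mu]_s (psi a (x 0 i + s) ^+ 2 *
     cos ((2 * pi * (l 0 i - y 0 i)) * s + (2 * pi * (x 0 i * l 0 i) - pi / 2)))).
Proof. by rewrite /cint; congr Complex; apply: eq_Rintegral => s _; rewrite FE. Qed.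

(** In coordinate [i] the angular frequency [2 * pi * (l i - y i)] lies beyond [2 * a], outside the
    band of [psi ^ 2]; this single zero factor kills the product. *)
Lemma fourier_test_fun0 (x l y : V) i : a < pi * `|l 0 i - y 0 i| ->
  fourier (test_fun a x l) y = 0.
Proof.
move=> H; rewrite fourier_test_fun (bigD1 i) //= cintE.
have H2 : 2 * a < `|2 * pi * (l 0 i - y 0 i)|.
  by rewrite !normrM (ger0_norm (pi_ge0 R)) ger0_norm // -mulrA ltr_pM2l.
by rewrite !psi_shift_integral0 // mul0r.
Qed.

Lemma fourier_test_fun1 (x l : V) :
  fourier (test_fun a x l) l = real_complex R (psi_norm2 a ^+ d) * cexp2pi (dotp x l).
Proof.
rewrite fourier_test_fun /dotp cexp2pi_sum rmorphXn.
have -> : real_complex R (psi_norm2 a) ^+ d = \prod_(i < d) real_complex R (psi_norm2 a).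
  by rewrite prodr_const card_ord.
rewrite -big_split; apply: eq_bigr => i _ /=.
rewrite cintE subrr mulr0 !psi_shift_integral1 //.
rewrite /cexp2pi -[in sin _](subrK (pi / 2) (2 * pi * (x 0 i * l 0 i))) sinDpihalf.
by apply/eqP; rewrite eq_complex /= !mul0r subr0 addr0 ![psi_norm2 a * _]mulrC !eqxx.
Qed.

End FourierTensor.

(** * Translation bounded weights *)

Section TranslationBounded.
Variables (R : realType) (d : nat).
Local Notation V := 'rV[R]_d.
Local Notation C := R[i].
Implicit Types (x t : V) (F : seq V).

(** Cells of side [1 / (d + 1)]: the sides of one cell add up to less than 1, so it fits in an open
    unit ball about its corner. *)
Let n : R := d.+1%:R.

Let n0 : 0 < n. Proof. by rewrite ltr0n. Qed.

Lemma sum_inv_sqr_le B : \sum_(m < B.+1) (1 + (m : nat)%:R : R) ^- 2 <= 2 - (B.+1%:R)^-1.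
Proof.
elim: B => [|B IH].
  by rewrite big_ord_recl big_ord0 /= !addr0 expr1n invr1; lra.
rewrite big_ord_recr /=; apply: (le_trans (lerD IH (lexx _))).
have b0 : (0 : R) < B.+1%:R by rewrite ltr0n.
have -> : (1 + B.+1%:R : R) = B.+2%:R by rewrite -[in RHS]natr1 addrC.
have -> : (B.+2%:R : R) = B.+1%:R + 1 by rewrite -natr1.
move: b0; set q : R := B.+1%:R => q0.
have q1 : 0 < q + 1 by lra.
rewrite -subr_ge0.
have -> : 2 - (q + 1)^-1 - (2 - q^-1 + (q + 1) ^- 2) = (q * (q + 1) ^+ 2)^-1.
  by field; rewrite !gt_eqF.
by rewrite invr_ge0 mulr_ge0 ?sqr_ge0 // ltW.
Qed.

Lemma coord_truncn (r : R) :
  (Num.truncn (n * `|r|))%:R <= n * `|r| < (Num.truncn (n * `|r|)).+1%:R.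
Proof. by rewrite truncn_itv // mulr_ge0 // ltW. Qed.

Lemma signed_dist (r q v : R) : 0 <= v -> q <= `|r| -> `|r| <= q + v ->
  `|r - (-1) ^+ (r < 0)%R * q| <= v.
Proof.
move=> v0; case: ltrP => r0; rewrite ?(ltr0_norm r0) ?(ger0_norm r0) ?expr0 ?expr1 => e1 e2;
  rewrite ler_norml; apply/andP; split; lra.
Qed.

(** Each cell carries mass at most [M], the weight is comparable to its value at the cell, and the
    sum of these values over a grid factors into [d] convergent one-dimensional sums. *)
Lemma translation_bounded_weight (Gam : set V) (b : V -> C) :
  translation_bounded Gam b -> exists2 K : R, 0 <= K &
  forall x F, uniq F -> (forall g, g \in F -> Gam g) ->
    \sum_(g <- F) cabs (b g) * \prod_i (1 + `|(x + g) 0 i|) ^- 2 <= K.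
Proof.
move=> [M HM].
have M0 : 0 <= M by have := HM 0 [::] isT; rewrite big_nil; apply.
(* Per coordinate: [n ^ 2] from [1 + m <= n * (1 + r)], a factor 2 for the two signs, and 2 as a
   bound for the sum of inverse squares. *)
exists (M * (4 * n ^+ 2) ^+ d).
  by rewrite mulr_ge0 // exprn_ge0 // mulr_ge0 // sqr_ge0.
move=> x F uF FG.
pose tr (g : V) i := Num.truncn (n * `|(x + g) 0 i|).
pose B := (\sum_(g <- F) \sum_i tr g i)%N.
have trB g i : g \in F -> (tr g i < B.+1)%N.
  move=> gF; rewrite ltnS /B (big_rem g) //= (bigD1 i) //= -addnA.
  exact: leq_addr.
pose cell (g : V) : {ffun 'I_d -> bool * 'I_B.+1} :=
  [ffun i => ((x + g) 0 i < 0, inord (tr g i))].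
pose wt (k : {ffun 'I_d -> bool * 'I_B.+1}) : R :=
  \prod_i (n ^+ 2 * (1 + (nat_of_ord (k i).2)%:R) ^- 2).
have wt0 k : 0 <= wt k.
  by apply: prodr_ge0 => i _; rewrite mulr_ge0 ?sqr_ge0 // invr_ge0 sqr_ge0.
have S1 : \sum_(g <- F) cabs (b g) * \prod_i (1 + `|(x + g) 0 i|) ^- 2 <=
    \sum_(g <- F) cabs (b g) * wt (cell g).
  rewrite big_seq [leRHS]big_seq; apply: ler_sum => g gF.
  rewrite ler_wpM2l ?cabs_ge0 // /wt; apply: ler_prod => i _.
  rewrite invr_ge0 sqr_ge0 /= ffunE /= inordK ?trB //.
  have /andP[t1 _] := coord_truncn ((x + g) 0 i); rewrite -/(tr g i) in t1.
  have r0 := normr_ge0 ((x + g) 0 i).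
  move: `|(x + g) 0 i| r0 t1 => r r0; set m : R := (tr g i)%:R => t1.
  have m0 : 0 <= m by rewrite ler0n.
  have n1 : 1 <= n by rewrite /n ler1n.
  have p1 : 0 < (1 + m) ^+ 2 by rewrite exprn_gt0 //; lra.
  have p2 : 0 < (1 + r) ^+ 2 by rewrite exprn_gt0 //; lra.
  rewrite ler_pdivlMr // mulrC ler_pdivrMr // -exprMn.
  by rewrite lerXn2r ?nnegrE //; nra.
apply: (le_trans S1).
rewrite (partition_big cell predT) //=.
have S2 k : \sum_(g <- F | cell g == k) cabs (b g) * wt (cell g) <= M * wt k.
  under eq_bigr => g /eqP -> do [].
  rewrite -mulr_suml ler_wpM2r // -big_filter.
  (* The corner of the cell nearest to the origin, moved back by [x]. *)
  pose c : V := \row_i ((-1) ^+ (k i).1 * (nat_of_ord (k i).2)%:R / n - x 0 i).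
  apply: (HM c); first exact: filter_uniq.
  move=> g; rewrite mem_filter => /andP[/eqP kE gF]; split; first exact: FG.
  apply: (le_lt_trans (enorm_le_sum _)).
  apply: (@le_lt_trans _ _ (\sum_(i < d) n^-1)); last first.
    rewrite sumr_const card_ord -mulr_natl ltr_pdivrMr // mul1r /n ltr_nat //.
  apply: ler_sum => i _; rewrite !mxE -kE ffunE /= inordK ?trB //.
  have := coord_truncn ((x + g) 0 i); rewrite -/(tr g i) -[in X in _ && X]natr1 !mxE.
  set u := x 0 i + g 0 i; set m : R := (tr g i)%:R => /andP[t1 t2].
  have -> : g 0 i - ((-1) ^+ (u < 0)%R * m / n - x 0 i) = u - (-1) ^+ (u < 0)%R * (m / n).
    by rewrite /u -mulrA opprB addrA [g 0 i + _]addrC.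
  have e1 : m / n <= `|u| by rewrite ler_pdivrMr // mulrC.
  have e2 : `|u| <= m / n + n^-1 
    by rewrite -[X in _ + X]mul1r -mulrDl ler_pdivlMr // mulrC ltW.
  have ni : 0 <= n^-1 by rewrite invr_ge0 ltW.
  exact: signed_dist.
apply: (le_trans (ler_sum _ (fun k _ => S2 k))).
rewrite -mulr_sumr ler_wpM2l // /wt.
rewrite -(bigA_distr_bigA (fun (_ : 'I_d) (j : bool * 'I_B.+1) =>
   n ^+ 2 * (1 + (nat_of_ord j.2)%:R) ^- 2)) /=.
rewrite prodr_const card_ord; apply: lerXn2r; rewrite ?nnegrE.
- by apply: sumr_ge0 => j _; rewrite mulr_ge0 ?sqr_ge0 // invr_ge0 sqr_ge0.
- by rewrite mulr_ge0 // sqr_ge0.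
rewrite -mulr_sumr mulrC ler_wpM2r ?sqr_ge0 //.
rewrite -(pair_big xpredT xpredT (fun (_ : bool) (j : 'I_B.+1) => (1 + (nat_of_ord j)%:R) ^- 2)) /=.
have H : \sum_(m < B.+1) (1 + (m : nat)%:R : R) ^- 2 <= 2.
  by apply: le_trans (sum_inv_sqr_le B) _; rewrite lerBlDr lerDl invr_ge0 ler0n.
by rewrite big_bool /=; apply: le_trans (lerD H H) _; rewrite -natrD.
Qed.

Variable a : R.
Hypothesis a0 : 0 < a.

Lemma psi_tensor_ge0 t : 0 <= psi_tensor a t.
Proof. by apply: prodr_ge0 => i _; exact: sqr_ge0. Qed.

(** [psi ^ 2] decays to fourth order, so beyond the summable second order a factor [1 + |t i|] can
    be spared. It becomes the gain [1 / (1 + r)] far from the origin. *)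
Lemma psi_tensor_decay : exists2 A : R, 0 <= A &
  (forall t i, (1 + `|t 0 i|) * psi_tensor a t <= A * \prod_i (1 + `|t 0 i|) ^- 2) /\
  (forall t, psi_tensor a t <= A * \prod_i (1 + `|t 0 i|) ^- 2).
Proof.
have [M HM] := psi_rapid a0 2.
exists ((M ^+ 2) ^+ d); first by rewrite exprn_ge0 // sqr_ge0.
have H (r : R) : (1 + `|r|) * psi a r ^+ 2 <= M ^+ 2 * (1 + `|r|) ^- 2 /\
    psi a r ^+ 2 <= M ^+ 2 * (1 + `|r|) ^- 2.
  have r0 := normr_ge0 r.
  have p2 : 0 < (1 + `|r|) ^+ 2 by rewrite exprn_gt0 //; lra.
  have := HM r; rewrite -[psi a r ^+ 2]real_normK ?num_real //.
  have s0 := normr_ge0 (psi a r).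
  rewrite !ler_pdivlMr //.
  move: `|r| `|psi a r| r0 s0 p2 => p q p0 q0 p2 Hq.
  have Q : ((1 + p) ^+ 2 * q) ^+ 2 <= M ^+ 2.
    have Hq0 : 0 <= (1 + p) ^+ 2 * q by rewrite mulr_ge0 // ltW.
    by rewrite lerXn2r ?nnegrE //; exact: le_trans Hq0 Hq.
  have E : ((1 + p) ^+ 2 * q) ^+ 2 = (1 + p) * ((1 + p) * q ^+ 2 * (1 + p) ^+ 2) by ring.
  have E0 : 0 <= q ^+ 2 * (1 + p) ^+ 2 by rewrite mulr_ge0 ?sqr_ge0.
  have E1 : (1 + p) * q ^+ 2 * (1 + p) ^+ 2 = (1 + p) * (q ^+ 2 * (1 + p) ^+ 2) by ring.
  rewrite E E1 in Q; rewrite E1; split; nra.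
have P : (M ^+ 2) ^+ d = \prod_(i < d) M ^+ 2 by rewrite prodr_const card_ord.
rewrite P; split=> [t i|t]; rewrite -big_split /=; last first.
  by apply: ler_prod => j _; rewrite sqr_ge0; have [] := H (t 0 j).
rewrite /psi_tensor (bigD1 i) //= [leRHS](bigD1 i) //= mulrA.
apply: ler_pM.
- by rewrite mulr_ge0 ?addr_ge0 // sqr_ge0.
- by apply: prodr_ge0 => j _; exact: sqr_ge0.
- by have [] := H (t 0 i).
- by apply: ler_prod => j _; rewrite sqr_ge0; have [] := H (t 0 j).
Qed.

Lemma tensor_sum_bounded (Gam : set V) (b : V -> C) : translation_bounded Gam b ->
  exists2 K : R, 0 <= K &
  (forall x F, uniq F -> (forall g, g \in F -> Gam g) ->
    \sum_(g <- F) cabs (b g) * psi_tensor a (x + g) <= K) /\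
  (forall r x F, 0 <= r -> uniq F -> (forall g, g \in F -> Gam g) ->
    (forall g, g \in F -> exists i, r < `|(x + g) 0 i|) ->
    \sum_(g <- F) cabs (b g) * psi_tensor a (x + g) <= K / (1 + r)).
Proof.
move=> /translation_bounded_weight[K K0 HK].
have [A A0 [HA1 HA2]] := psi_tensor_decay.
exists (A * K) => [|]; first exact: mulr_ge0.
split=> [x F uF FG|r x F r0 uF FG Hr].
  apply: le_trans (ler_wpM2l A0 (HK x F uF FG)).
  rewrite mulr_sumr; apply: ler_sum => g _; rewrite [leRHS]mulrCA.
  exact: (ler_wpM2l (cabs_ge0 (b g)) (HA2 (x + g))).
have r1 : 0 < 1 + r by lra.
rewrite ler_pdivlMr //.
apply: le_trans (ler_wpM2l A0 (HK x F uF FG)).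
rewrite mulr_sumr mulr_suml big_seq [leRHS]big_seq; apply: ler_sum => g gF.
rewrite mulrCA -mulrA ler_wpM2l ?cabs_ge0 //.
have [i ri] := Hr g gF; apply: le_trans (HA1 (x + g) i).
by rewrite mulrC ler_wpM2r ?psi_tensor_ge0 // lerD2l ltW.
Qed.

End TranslationBounded.

(** * Coherence from a compact sup bound *)

Section AlmostPeriodicity.
Variables (R : realType) (d : nat).
Local Notation V := 'rV[R]_d.
Local Notation C := R[i].
Implicit Types (s : seq V) (a : V -> C) (f : V -> C).

Lemma cabs_le_ReIm (z : C) : cabs z <= `|complex.Re z| + `|complex.Im z|.
Proof.
case: z => u v; rewrite /cabs /=.
have H : 0 <= `|u| + `|v| by rewrite addr_ge0.
rewrite -(ger0_norm H) -sqrtr_sqr; apply: ler_wsqrtr.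
rewrite -[u ^+ 2]real_normK ?num_real // -[v ^+ 2]real_normK ?num_real //.
have := normr_ge0 u; have := normr_ge0 v; move: `|u| `|v| => p q; nra.
Qed.

(* Phases are sorted by the grid cell of their cosine and sine; one
   representative per occupied tuple of cells is a finite net. *)
Lemma phase_net s (e : R) : 0 < e -> exists X : seq V, forall x, exists2 y, y \in X &
  forall l, l \in s -> cabs (cexp2pi (dotp x l) - cexp2pi (dotp y l)) <= e.
Proof.
move=> e0.
have [N NH] : exists N : nat, 2 / e < N%:R.
  by exists (Num.bound (2 / e)); apply: archi_boundP; rewrite divr_ge0 // ltW.
have N0 : 0 < (N%:R : R) by apply: lt_trans NH; rewrite divr_gt0.
(* [N * (1 + u)] ranges over [[0, 2 * N]] with the right end attained, hence [2 * N + 1] cells. *)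
pose cell (u : R) : 'I_(2 * N).+1 := inord (Num.truncn (N%:R * (1 + u))).
have cellP (u v : R) : -1 <= u <= 1 -> -1 <= v <= 1 -> cell u = cell v -> `|u - v| <= N%:R^-1.
  have tP (r : R) : -1 <= r <= 1 ->
     (nat_of_ord (cell r))%:R <= N%:R * (1 + r) < (nat_of_ord (cell r))%:R + 1.
    move=> /andP[r1 r2].
    have p0 : 0 <= N%:R * (1 + r) by rewrite mulr_ge0 ?(ltW N0) //; lra.
    have := truncn_itv p0; rewrite -natr1 /cell inordK // ltnS.
    have /andP[H _] := truncn_itv p0.
    rewrite -(ler_nat R); apply: (le_trans H); rewrite natrM mulrC ler_pM2r //; lra.
  move=> /tP/andP[u1 u2] /tP/andP[v1 v2] E; rewrite E in u1 u2.
  rewrite -[leRHS]mul1r ler_pdivlMr // -[X in _ * X](gtr0_norm N0) -normrM ler_norml.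
  by apply/andP; split; nra.
pose lab (x : V) : {ffun 'I_(size s) -> 'I_(2 * N).+1 * 'I_(2 * N).+1} :=
  [ffun i : 'I_(size s) => (cell (cos (2 * pi * dotp x s`_i)), cell (sin (2 * pi * dotp x s`_i)))].
have [rep Hrep] : exists rep : {ffun 'I_(size s) -> 'I_(2 * N).+1 * 'I_(2 * N).+1} -> V,
    forall x, lab (rep (lab x)) = lab x.
  have /choice[rep H] : forall k, exists y, (exists x, lab x = k) -> lab y = k.
    move=> k; case: (pselect (exists x, lab x = k)) => [[x xk]|H]; first by exists x.
    by exists 0.
  by exists rep => x; apply: H; exists x.
exists [seq rep k | k <- enum {ffun 'I_(size s) -> 'I_(2 * N).+1 * 'I_(2 * N).+1}] => x.
exists (rep (lab x)); first by apply/mapP; exists (lab x) => //; rewrite mem_enum.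
move=> l /(nthP 0)[i ils <-].
have := congr1 (fun h : {ffun _ -> _} => h (Ordinal ils)) (Hrep x).
rewrite !ffunE /= => -[E1 E2].
apply: (le_trans (cabs_le_ReIm (cexp2pi (dotp x s`_i) - cexp2pi (dotp (rep (lab x)) s`_i)))) => /=.
have F1 := cellP _ _ _ _ E1; have F2 := cellP _ _ _ _ E2.
rewrite distrC [X in _ + X]distrC.
apply: (@le_trans _ _ (N%:R^-1 + N%:R^-1)).
  by apply: lerD; [apply: F1|apply: F2]; rewrite ?cos_geN1 ?cos_le1 ?sin_geN1 ?sin_le1.
have -> : N%:R^-1 + N%:R^-1 = 2 / N%:R :> R by rewrite mulr_natl mulr2n.
rewrite ler_pdivrMr //.
by move: NH; rewrite ltr_pdivrMr // mulrC => /ltW.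
Qed.

(** If [y] in the net has nearly the phases of [x], then [x - y] has phases near 0, and it lies at
    distance [enorm y] from [x], which is bounded because the net is finite. *)
Lemma phase_relatively_dense s (e : R) : 0 < e -> exists2 L : R, 0 < L &
  forall x : V, exists2 tau, enorm (tau - x) < L &
    forall l, l \in s -> cabs (cexp2pi (dotp tau l) - 1) <= e.
Proof.
move=> e0; have [X HX] := phase_net s e0.
exists (1 + \sum_(y <- X) enorm y).
  by rewrite ltr_wpDr // sumr_ge0 // => y _; exact: enorm_ge0.
move=> x; have [y yX H] := HX x; exists (x - y) => [|l ls].
  have -> : x - y - x = - y by rewrite addrAC subrr add0r.
  have -> : enorm (- y) = enorm y.
    by rewrite /enorm dotpNl dotpC dotpNl opprK.
  rewrite (big_rem y) //= ltr_pwDl // lerDl sumr_ge0 // => z _; exact: enorm_ge0.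
have -> : cexp2pi (dotp (x - y) l) - 1 =
    cexp2pi (- dotp y l) * (cexp2pi (dotp x l) - cexp2pi (dotp y l)).
  by rewrite dotpDl dotpNl [dotp x l + _]addrC cexp2piD mulrBr cexp2piN.
by rewrite cabsM cabs_cexp2pi mul1r H.
Qed.

Lemma cexp2pi_continuous (t e : R) : 0 < e -> exists2 r : R, 0 < r &
  forall u, `|u - t| < r -> cabs (cexp2pi u - cexp2pi t) < e.
Proof.
move=> e0; have e2 : 0 < e / 2 by rewrite divr_gt0.
have D (u : R) : is_derive u 1 (fun u : R => 2 * pi * u) (2 * pi).
  have -> : (fun u : R => 2 * pi * u) = (fun u : R => 2 * pi * u + 0).
    by apply/funext => v; rewrite addr0.
  exact: is_derive_affine.
have cc : continuous (fun u : R => cos (2 * pi * u)).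
  by move=> u; exact: (is_derive_continuous (is_derive_comp1 (is_derive_cos _) (D u))).
have cs : continuous (fun u : R => sin (2 * pi * u)).
  by move=> u; exact: (is_derive_continuous (is_derive_comp1 (is_derive_sin _) (D u))).
have /cvgrPdist_lt/(_ _ e2)/nbhs_ballP[r1 /= r10 H1] := cc t.
have /cvgrPdist_lt/(_ _ e2)/nbhs_ballP[r2 /= r20 H2] := cs t.
exists (Num.min r1 r2); first by rewrite lt_min r10.
move=> u; rewrite lt_min => /andP[u1 u2].
apply: (le_lt_trans (cabs_le_ReIm (cexp2pi u - cexp2pi t))) => /=; rewrite [e]splitr.
apply: ltrD; rewrite distrC; [apply: H1|apply: H2]; by rewrite /ball /= distrC.
Qed.

Lemma coord_le_enorm (x : V) i : `|x 0 i| <= enorm x.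
Proof.
rewrite /enorm -sqrtr_sqr; apply: ler_wsqrtr; rewrite /dotp (bigD1 i) //= expr2 lerDl.
by apply: sumr_ge0 => j _; rewrite -expr2 sqr_ge0.
Qed.

Lemma dotp_le (x l : V) : `|dotp x l| <= enorm x * \sum_i `|l 0 i|.
Proof.
rewrite /dotp (le_trans (ler_norm_sum _ _ _)) // mulr_sumr; apply: ler_sum => i _.
by rewrite normrM ler_wpM2r // coord_le_enorm.
Qed.

Lemma expsum_continuous s a x (e : R) : 0 < e -> exists2 r : R, 0 < r &
  forall y, enorm (y - x) < r -> cabs (expsum s a y - expsum s a x) < e.
Proof.
elim: s e => [|l s IH] e e0.
  by exists 1 => // y _; rewrite /expsum !big_nil subrr cabs0.
have e2 : 0 < e / 2 by rewrite divr_gt0.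
have [r1 r10 H1] := IH _ e2.
have A0 : 0 < cabs (a l) + 1 by rewrite ltr_wpDl // cabs_ge0.
have [r2 r20 H2] := cexp2pi_continuous (dotp x l) (divr_gt0 e2 A0).
have L0 : 0 < \sum_i `|l 0 i| + 1 by rewrite ltr_wpDl // sumr_ge0.
exists (Num.min r1 (r2 / (\sum_i `|l 0 i| + 1))).
  by rewrite lt_min r10 divr_gt0.
move=> y; rewrite lt_min => /andP[y1 y2].
have -> : expsum (l :: s) a y - expsum (l :: s) a x =
   a l * (cexp2pi (dotp y l) - cexp2pi (dotp x l)) + (expsum s a y - expsum s a x).
  by rewrite /expsum !big_cons; ring.
apply: (le_lt_trans (cabsD _ _)); rewrite [e]splitr cabsM; apply: ler_ltD; last exact: H1.
have K : cabs (cexp2pi (dotp y l) - cexp2pi (dotp x l)) < e / 2 / (cabs (a l) + 1).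
  apply: H2; rewrite -[X in _ - X]opprK -dotpNl -dotpNl opprK.
  have -> : dotp y l - dotp x l = dotp (y - x) l by rewrite dotpDl dotpNl.
  apply: (le_lt_trans (dotp_le _ _)); rewrite ltr_pdivlMr // in y2.
  apply: le_lt_trans y2; rewrite ler_wpM2l ?enorm_ge0 //; lra.
rewrite ltr_pdivlMr // in K; have := cabs_ge0 (cexp2pi (dotp y l) - cexp2pi (dotp x l)).
have := cabs_ge0 (a l); move: (cabs (a l)) (cabs (_ - _)) K => p q K; nra.
Qed.

Lemma expsum_almost_periods s a (e : R) : 0 < e -> exists2 L : R, 0 < L &
  forall z : V, exists tau, enorm (tau - z) < L /\
    forall x, cabs (expsum s a (x + tau) - expsum s a x) <= e.
Proof.
move=> e0.
have S0 : 0 <= \sum_(l <- s) cabs (a l) by apply: sumr_ge0 => l _; exact: cabs_ge0.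
have S1 : 0 < \sum_(l <- s) cabs (a l) + 1 by rewrite ltr_wpDl.
have [L L0 H] := phase_relatively_dense s (divr_gt0 e0 S1).
exists L => // z; have [tau tz Ht] := H z; exists tau; split => // x.
have -> : expsum s a (x + tau) - expsum s a x =
    \sum_(l <- s) a l * cexp2pi (dotp x l) * (cexp2pi (dotp tau l) - 1).
  rewrite /expsum -sumrB; apply: eq_bigr => l _.
  by rewrite dotpDl cexp2piD; ring.
apply: (le_trans (cabs_sum _ _)).
apply: (@le_trans _ _ (\sum_(l <- s) cabs (a l) * (e / (\sum_(l <- s) cabs (a l) + 1)))).
  rewrite big_seq [leRHS]big_seq; apply: ler_sum => l ls.
  by rewrite !cabsM cabs_cexp2pi mulr1 ler_wpM2l ?cabs_ge0 ?Ht.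
rewrite -mulr_suml mulrCA ger_pMr // ler_pdivrMr // mul1r; lra.
Qed.

Lemma bohr_ap_uniform_limit f :
  (forall e : R, 0 < e -> exists s a, forall x, cabs (expsum s a x - f x) <= e) ->
  bohr_ap f.
Proof.
move=> H; split=> [x e e0|e e0].
  have e4 : 0 < e / 4 by rewrite divr_gt0.
  have [s [a Hf]] := H _ e4.
  have [r r0 Hr] := expsum_continuous s a x e4.
  exists r => // y /Hr K.
  apply: (le_lt_trans (cabs_dist _ (expsum s a y) _)).
  rewrite cabsC; have := cabs_dist (expsum s a y) (expsum s a x) (f x).
  have := Hf x; have := Hf y; lra.
have e4 : 0 < e / 4 by rewrite divr_gt0.
have [s [a Hf]] := H _ e4.
have [L L0 HL] := expsum_almost_periods s a e4.
exists L => // z; have [tau [tz Ht]] := HL z; exists tau; split => // x.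
apply: (le_trans (cabs_dist _ (expsum s a (x + tau)) _)).
rewrite cabsC; have := cabs_dist (expsum s a (x + tau)) (expsum s a x) (f x).
have := Hf x; have := Hf (x + tau); have := Ht x; lra.
Qed.

(** Coefficients are functions of the frequency, so sums with different coefficient functions cannot
    just be concatenated. A common list without repetition, with multiplicities moved into the
    coefficients, makes them comparable. *)
Lemma expsum_count s u a x : uniq u -> {subset s <= u} ->
  expsum s a x = expsum u (fun l => (count_mem l s)%:R * a l) x.
Proof.
move=> uu; elim: s => [|k s IH] sub.
  by rewrite /expsum big_nil big1 // => l _; rewrite mul0r mul0r.
rewrite {1}/expsum big_cons -/(expsum s a x) IH; last first.
  by move=> l ls; apply: sub; rewrite inE ls orbT.
have -> : a k * cexp2pi (dotp x k) = expsum u (fun l => (k == l)%:R * a l) x.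
  rewrite /expsum (bigD1_seq k) ?sub ?mem_head //= eqxx mul1r.
  by rewrite big1 ?addr0 // => l /negbTE; rewrite eq_sym => ->; rewrite mul0r mul0r.
by rewrite -expsumD; apply: eq_expsum => l _ /=; rewrite natrD mulrDl.
Qed.

Lemma exp_sum_onB (U : set V) (P Q : V -> C) : exp_sum_on U P -> exp_sum_on U Q ->
  exists s a, (forall l, l \in s -> U l) /\ forall x, P x - Q x = expsum s a x.
Proof.
move=> [s1 [a1 [U1 E1]]] [s2 [a2 [U2 E2]]].
pose u := undup (s1 ++ s2).
have uu : uniq u by exact: undup_uniq.
exists u, (fun l => (count_mem l s1)%:R * a1 l + (-1) * ((count_mem l s2)%:R * a2 l)).
split=> [l|x].
  by rewrite mem_undup mem_cat => /orP[/U1|/U2].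
rewrite expsumD expsumZ mulN1r -!expsum_count //.
- by rewrite E1 E2.
- by move=> l ls; rewrite mem_undup mem_cat ls orbT.
- by move=> l ls; rewrite mem_undup mem_cat ls.
Qed.

(** [P N - P n] is small on the cube, hence everywhere. Here [N] comes from the cube alone, while
    [n] may depend on [x] through convergence on the compact set [[set x]]; so [P N] is uniformly
    close to [f]. *)
Lemma coherent_of_sup_bound (U : set V) (r K : R) :
  (forall s a M, (forall l, l \in s -> U l) ->
     (forall y : V, (forall i, `|y 0 i| <= r) -> cabs (expsum s a y) <= M) ->
     forall x, cabs (expsum s a x) <= K * M) ->
  forall (P : nat -> V -> C) f, (forall n, exp_sum_on U (P n)) -> cvg_compact P f -> bohr_ap f.
Proof.
move=> HU P f HP Pf; apply: bohr_ap_uniform_limit => e e0.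
have cK : compact [set y : V | forall i, `[- r, r]%classic (y ord0 i)].
  by apply: (@rV_compact R d (fun=> `[- r, r]%classic)) => i; exact: segment_compact.
have K1 : 0 < `|K| + 1 by rewrite ltr_wpDl.
have e1 : 0 < e / (4 * (`|K| + 1)) by rewrite divr_gt0 // mulr_gt0.
have [N HN] := Pf _ cK _ e1.
have [s [a [sU E]]] := HP N.
exists s, a => x; rewrite -[expsum s a x]E.
have e2 : 0 < e / 2 by rewrite divr_gt0.
have [N2 HN2] := Pf _ (@compact_set1 _ x) _ e2.
pose n := maxn N N2.
have H1 : cabs (P n x - f x) < e / 2 by apply: HN2 => //; exact: leq_maxr.
have [s' [a' [s'U E']]] := exp_sum_onB (HP N) (HP n).
have H2 : cabs (P N x - P n x) <= K * (2 * (e / (4 * (`|K| + 1)))).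
  rewrite E'; apply: HU => // y yr.
  have yK : forall i, `[- r, r]%classic (y ord0 i) by move=> i; rewrite /= in_itv /= -ler_norml.
  rewrite -E'; apply: (le_trans (cabs_dist _ (f y) _)).
  have := HN N (leqnn _) y yK; have := HN n (leq_maxl _ _) y yK.
  rewrite [cabs (P n y - f y)]cabsC; lra.
have H3 : K * (2 * (e / (4 * (`|K| + 1)))) <= e / 2.
  have -> : K * (2 * (e / (4 * (`|K| + 1)))) = (K / (`|K| + 1)) * (e / 2).
    by field; rewrite gt_eqF.
  rewrite ger_pMl // ler_pdivrMr // mul1r; have := ler_norm K; lra.
apply: (le_trans (cabs_dist _ (P n x) _)); lra.
Qed.

End AlmostPeriodicity.

(** * The sup bound and coherence *)

Section CoherentFrequencies.
Variables (R : realType) (d : nat).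
Local Notation V := 'rV[R]_d.
Local Notation C := R[i].
Implicit Types (s : seq V) (a : V -> C).

Lemma has_sum_point (A : set V) (u : V -> C) (S : C) l : A l ->
  (forall l', A l' -> l' <> l -> u l' = 0) -> has_sum A u S -> S = u l.
Proof.
move=> Al u0 HS; apply/eqP; rewrite eq_sym -subr_eq0; apply/eqP/cabs_eq0/eqP.
rewrite eq_le cabs_ge0 andbT; apply/ler_addgt0Pl => e e0; rewrite addr0.
have [s0 [us0 As0 H]] := HS e e0.
have uw : uniq (undup (l :: s0)) by exact: undup_uniq.
have lw : l \in undup (l :: s0) by rewrite mem_undup mem_head.
have Aw l' : l' \in undup (l :: s0) -> A l'.
  by rewrite mem_undup inE => /orP[/eqP ->|/As0].
have sw : {subset s0 <= undup (l :: s0)}.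
  by move=> l' l's; rewrite mem_undup inE l's orbT.
move: (undup (l :: s0)) uw lw Aw sw => w uw lw Aw sw.
have := H w uw Aw sw; rewrite (bigD1_seq l) //=.
rewrite big_seq_cond big1 ?addr0 => [/ltW //|l' /andP[/Aw Al' /eqP]].
exact: u0.
Qed.

(** Origin of the band [eps / (d + 1)]: were all coordinates smaller, the distance would be at most
    [d * eps / (d + 1) < eps]. The factor [pi >= 2] makes the inequality strict. *)
Lemma separated_coord (eps : R) (l l' : V) : 0 < eps -> eps <= enorm (l - l') ->
  exists i, eps / d.+1%:R < pi * `|l 0 i - l' 0 i|.
Proof.
move=> eps0 H; set a := eps / _.
have n0 : (0 : R) < d.+1%:R by rewrite ltr0n.
have a0 : 0 < a by rewrite divr_gt0.
suff [i Hi] : exists i, a <= `|(l - l') 0 i|.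
  exists i; apply: (@lt_le_trans _ _ (2 * a)); first lra.
  have := pi_ge2 R; rewrite !mxE in Hi; move: (pi : R) `|_ - _| Hi => p q; nra.
apply/not_existsP => K.
have : enorm (l - l') <= \sum_(i < d) a.
  apply: (le_trans (enorm_le_sum _)); apply: ler_sum => i _.
  by have /negP := K i; rewrite -ltNge => /ltW.
rewrite sumr_const card_ord -mulr_natl => K2.
have : d%:R * a < eps.
  rewrite /a mulrCA gtr_pMr // ltr_pdivrMr // mul1r ltr_nat //.
by rewrite ltNge (le_trans H K2).
Qed.

Lemma spectral_representation (Lam Gam : set V) (c b : V -> C) (eps : R) (l : V) :
  0 < eps -> Lam l -> (forall l', Lam l' -> l' <> l -> eps <= enorm (l - l')) ->
  (forall phi : V -> C, schwartz phi -> exists S : C,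
      has_sum Lam (fun l => c l * fourier phi l) S /\
      has_sum Gam (fun g => b g * phi g) S) ->
  forall x, has_sum Gam (fun g => b g * test_fun (eps / d.+1%:R) x l g)
    (c l * (real_complex R (psi_norm2 (eps / d.+1%:R) ^+ d) * cexp2pi (dotp x l))).
Proof.
move=> eps0 Ll sep HS x.
have a0 : 0 < eps / d.+1%:R by rewrite divr_gt0.
have [S [S1 S2]] := HS _ (test_fun_schwartz a0 x l).
rewrite -(fourier_test_fun1 a0) -(has_sum_point Ll _ S1) // => l' Ll' l'l.
have [i Hi] := separated_coord eps0 (sep _ Ll' l'l).
by rewrite (fourier_test_fun0 a0 x Hi) mulr0.
Qed.

Lemma sup_bound (Lam : set V) (c : V -> C) (U : set V) (eps : R) :
  fourier_is_atomic_tb Lam c -> U `<=` Lam -> 0 < eps ->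
  (forall l, U l -> eps <= cabs (c l)) ->
  (forall l, U l -> forall l', Lam l' -> l' <> l -> eps <= enorm (l - l')) ->
  exists r K : R, forall s a M, (forall l, l \in s -> U l) ->
     (forall y : V, (forall i, `|y 0 i| <= r) -> cabs (expsum s a y) <= M) ->
     forall x, cabs (expsum s a x) <= K * M.
Proof.
move=> [Gam [b [[_ tbG] HS]]] UL eps0 ceps sep.
set e := eps / d.+1%:R.
have e0 : 0 < e by rewrite divr_gt0.
pose k := psi_norm2 e ^+ d.
have k0 : 0 < k by rewrite exprn_gt0 // psi_norm2_gt0.
have rep l : U l -> forall x, has_sum Gam (fun g => b g * test_fun e x l g)
    (c l * (real_complex R k * cexp2pi (dotp x l))).
  by move=> Ul; apply: spectral_representation (UL _ Ul) (sep _ Ul) HS.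
have [K K0 [HK1 HK2]] := tensor_sum_bounded e0 tbG.
have cabs_psi g : cabs (b g * real_complex R (psi_tensor e g)) = cabs (b g) * psi_tensor e g.
  by rewrite cabsM cabs_real ger0_norm // psi_tensor_ge0.
have [D D0 HD] : divisible_on (fun l => c l * real_complex R k) U.
  apply: (@wiener_division _ _ U Gam (fun g => b g * real_complex R (psi_tensor e g)) _
    K (eps * k)).
  - by rewrite mulr_gt0.
  - move=> F uF FG; have := HK1 0 F uF FG.
    by under eq_bigr do rewrite add0r -cabs_psi.
  - move=> l Ul; have := rep l Ul 0; rewrite dotp0l cexp2pi0 mulr1.
    by under eq_fun do rewrite /test_fun add0r mulrA.
  - by move=> l Ul; rewrite cabsM cabs_real gtr0_norm // ler_pM2r // ceps.
(* Then [D * K / (1 + r) <= 1 / 2], so the far part can be absorbed; [D] and [K] were fixed before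
   [r]. *)
pose r := 2 * D * K.
have r0 : 0 <= r by rewrite !mulr_ge0.
have r1 : 0 < 1 + r by lra.
exists r, (2 * (D * K)) => s a M sU aM x; rewrite -mulrA.
move: x; apply: (half_contraction_bound (expsum_bounded s a)) => B aB x.
have B0 : 0 <= B := le_trans (cabs_ge0 _) (aB 0).
have M0 : 0 <= M.
  by apply: le_trans (cabs_ge0 (expsum s a 0)) (aM 0 _) => i; rewrite mxE normr0.
have T y : cabs (expsum s (fun l => a l * (c l * real_complex R k)) y) <= K * M + K / (1 + r) * B.
  apply/ler_addgt0Pr => z z0.
  have A1 : 0 < \sum_(l <- s) cabs (a l) + 1.
    by rewrite ltr_wpDl // sumr_ge0 // => l _; exact: cabs_ge0.
  (* One finite part of [Gam] serves all frequencies of [s] at once, so the identities can be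
     combined linearly before the sum is split. *)
  have [F [uF FG HF]] := @has_sum_seq _ _ Gam b (fun g l => test_fun e y l g)
    (fun l => c l * (real_complex R k * cexp2pi (dotp y l))) s _ (divr_gt0 z0 A1)
    (fun l ls => rep l (sU l ls) y).
  have {}HF := HF F uF FG (fun g gF => gF).
  pose Q := \sum_(g <- F) b g * real_complex R (psi_tensor e (y + g)) * expsum s a (y + g).
  have QE : Q = \sum_(l <- s) a l * (\sum_(g <- F) b g * test_fun e y l g).
    rewrite /Q; under eq_bigr do rewrite /expsum mulr_sumr.
    rewrite exchange_big; apply: eq_bigr => l _; rewrite mulr_sumr; apply: eq_bigr => g _.
    by rewrite /test_fun /=; ring.
  have H1 : cabs (expsum s (fun l => a l * (c l * real_complex R k)) y - Q) <= z.
    rewrite QE /expsum -sumrB; apply: (le_trans (cabs_sum _ _)).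
    apply: (@le_trans _ _ (\sum_(l <- s) cabs (a l) * (z / (\sum_(l <- s) cabs (a l) + 1)))).
      rewrite big_seq [leRHS]big_seq; apply: ler_sum => l ls.
      rewrite -!mulrA -mulrBr cabsM ler_wpM2l ?cabs_ge0 // cabsC; exact/ltW/HF.
    rewrite -mulr_suml mulrCA ger_pMr // ler_pdivrMr // mul1r; lra.
  have H2 : cabs Q <= K * M + K / (1 + r) * B.
    (* Near points evaluate the sum inside the cube, where [M] bounds it; far points allow only the
       global bound [B], but their total weight is at most [K / (1 + r)]. *)
    pose near (g : V) := [forall i, `|(y + g) 0 i| <= r].
    apply: (le_trans (cabs_sum _ _)).
    rewrite (bigID near) /=; apply: lerD.
      apply: (@le_trans _ _ ((\sum_(g <- [seq g <- F | near g]) cabs (b g) * psi_tensor e (y + g)) * M)).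
        rewrite big_filter mulr_suml; apply: ler_sum => g /forallP gn.
        by rewrite !cabsM cabs_real ger0_norm ?psi_tensor_ge0 // ler_wpM2l ?mulr_ge0 ?cabs_ge0 ?psi_tensor_ge0 // aM.
      rewrite ler_wpM2r //; apply: HK1; first exact: filter_uniq.
      by move=> g; rewrite mem_filter => /andP[_ /FG].
    apply: (@le_trans _ _ ((\sum_(g <- [seq g <- F | ~~ near g]) cabs (b g) * psi_tensor e (y + g)) * B)).
      rewrite big_filter mulr_suml; apply: ler_sum => g _.
      by rewrite !cabsM cabs_real ger0_norm ?psi_tensor_ge0 // ler_wpM2l ?mulr_ge0 ?cabs_ge0 ?psi_tensor_ge0.
    rewrite ler_wpM2r //; apply: HK2 => //; first exact: filter_uniq.
      by move=> g; rewrite mem_filter => /andP[_ /FG].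
    move=> g; rewrite mem_filter => /andP[ng _].
    move: ng; rewrite negb_forall => /existsP; case=> i.
    by rewrite -ltNge => Hi; exists i.
  by rewrite -[X in cabs X](subrK Q) addrC; apply: (le_trans (cabsD _ _)); exact: lerD.
apply: (le_trans (HD s a _ sU T x)).
rewrite mulrDr !mulrA lerD2l [leRHS]mulrC ler_wpM2r // ler_pdivrMr // /r; lra.
Qed.

End CoherentFrequencies.

Theorem theorem9 (R : realType) (d : nat) (Lam : set 'rV[R]_d)
  (c : 'rV[R]_d -> R[i]) (U : set 'rV[R]_d) (eps : R) :
  atomic_tb_measure Lam c ->
  fourier_is_atomic_tb Lam c ->
  U `<=` Lam ->
  0 < eps ->
  (forall l, U l -> eps <= cabs (c l)) ->
  (forall l, U l -> forall l', Lam l' -> l' <> l -> eps <= enorm (l - l')) ->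
  coherent U.
Proof.
move=> _ Hhat UL eps0 ceps sep; split.
  exists eps => // u v Uu Uv uv; apply: sep => //; first exact: UL.
  by move=> E; apply: uv.
have [r [K HK]] := sup_bound Hhat UL eps0 ceps sep.
exact: coherent_of_sup_bound HK.
Qed.
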